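(* Consider a network of $N$ Euler-Lagrange agents with joint positions $\mathbf{x}_i\in\mathbb{R}^n$ and dynamics $$\mathbf{M}_i(\mathbf{x}_i)\ddot{\mathbf{x}}_i+\mathbf{C}_i(\mathbf{x}_i,\dot{\mathbf{x}}_i)\dot{\mathbf{x}}_i+\mathbf{g}_i(\mathbf{x}_i)=\boldsymbol{\tau}_i,\qquad i=1,\dots,N,$$ with time-varying communication delays $0\le d_{ji}(t)\le\overline{d}_{ji}$ from agent $j$ to agent $i$. Assume that the undirected communication graph is initially connected and that each pair of initially adjacent agents is strictly within communication distance: for some $\epsilon>0$, $|\mathbf{x}_i(0)-\mathbf{x}_j(0)|\le r-\epsilon$ for all $(i,j)\in\mathcal{E}(0)$. Let the control torques be $$\boldsymbol{\tau}_i=-p\sum_{j\in\mathcal{N}_i(0)}\nabla_i\psi(|\mathbf{x}^d_{ij}|)-\mathbf{K}_i\dot{\mathbf{x}}_i+\mathbf{g}_i(\mathbf{x}_i),$$ where $p>0$, $\mathbf{K}_i$ is a positive diagonal gain matrix with smallest eigenvalue $k_i$, and $\psi$ is the potential given in the context, with parameter $Q>0$ such that $\frac{N(N-1)}{2}\psi(r-\epsilon)<\psi(r)$. Let $\gamma,\eta>0$ be constants for which the gradient-mismatch property stated in the context holds. If the parameter $p$ and the damping gains $\mathbf{K}_i$ can be selected to satisfy $$\frac12\sum_{i=1}^N\dot{\mathbf{x}}_i(0)^{\mathsf T}\mathbf{M}_i(\mathbf{x}_i(0))\dot{\mathbf{x}}_i(0)+\frac p2\sum_{i=1}^N\sum_{j\in\mathcal{N}_i(0)}\psi(|\mathbf{x}_{ij}(0)|)<p\,\psi(r)$$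 and, for every $i=1,\dots,N$, $$k_i>\frac p2\sum_{j\in\mathcal{N}_i(0)}\left(\alpha_{ij}(\gamma+\eta)+\frac{(\gamma+n\eta)\,\overline{d}_{ij}^{\,2}}{\alpha_{ji}}\right),$$ with $\alpha_{ij}$ positive constants, then the control torques synchronize the network, i.e. $\mathbf{x}_i(t)-\mathbf{x}_j(t)\to\mathbf{0}$ as $t\to\infty$ for all $i,j\in\{1,\dots,N\}$, and preserve its connectivity, i.e. $|\mathbf{x}_i(t)-\mathbf{x}_j(t)|<r$ for all $(i,j)\in\mathcal{E}(0)$ and all $t\ge0$.
   Context: $r>0$ is the common broadcasting radius of the agents and $|\cdot|$ is the Euclidean norm. $\mathcal{E}(0)$ is the initial edge set of the undirected communication graph ($(i,j)\in\mathcal{E}(0)$ iff $(j,i)\in\mathcal{E}(0)$), and $\mathcal{N}_i(0)=\{j:(i,j)\in\mathcal{E}(0)\}$ is the set of initial neighbours of agent $i$. The communication graph is treated as static (no new links are created), and preserving connectivity means maintaining all initial communication links. Agents: $\mathbf{M}_i$ is the inertia matrix, $\mathbf{C}_i$ the matrix of Coriolis and centrifugal effects, $\mathbf{g}_i$ the gravity torque and $\boldsymbol{\tau}_i$ the control torque of agent $i$, which has only revolute joints. The dynamics have the properties: (1) $\mathbf{M}_i(\mathbf{x}_i)$ is symmetric, positive definite and uniformly bounded, $0<\lambda_{i1}\mathbf{I}\preceq\mathbf{M}_i(\mathbf{x}_i)\preceq\lambda_{i2}\mathbf{I}<\infty$; (2) $\dot{\mathbf{M}}_i(\mathbf{x}_i)-2\mathbf{C}_i(\mathbf{x}_i,\dot{\mathbf{x}}_i)$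 is skew-symmetric. Notation: $\mathbf{x}_{ij}=\mathbf{x}_i-\mathbf{x}_j$; $\mathbf{x}_{jd}=\mathbf{x}_j(t-d_{ji}(t))$ is the delayed position of agent $j$ received by agent $i$; $\mathbf{x}^d_{ij}=\mathbf{x}_i(t)-\mathbf{x}_j(t-d_{ji}(t))$. Potential: for $Q>0$, $\psi(|\mathbf{x}_{ij}|)=\dfrac{|\mathbf{x}_{ij}|^2}{r^2-|\mathbf{x}_{ij}|^2+Q}$ (so $\psi(s)=s^2/(r^2-s^2+Q)$ for scalars $s$). The gradients with respect to $\mathbf{x}_i$ are $\nabla_i\psi(|\mathbf{x}_{ij}|)=\dfrac{2(r^2+Q)}{(r^2-|\mathbf{x}_{ij}|^2+Q)^2}\,\mathbf{x}_{ij}$ and $\nabla_i\psi(|\mathbf{x}^d_{ij}|)=\dfrac{2(r^2+Q)}{(r^2-|\mathbf{x}^d_{ij}|^2+Q)^2}\,\mathbf{x}^d_{ij}$. Energy function: $V=\frac12\sum_{i=1}^N\dot{\mathbf{x}}_i^{\mathsf T}\mathbf{M}_i(\mathbf{x}_i)\dot{\mathbf{x}}_i+\frac p2\sum_{i=1}^N\sum_{j\in\mathcal{N}_i(0)}\psi(|\mathbf{x}_{ij}|)$. Gradient-mismatch property with constants $\gamma,\eta>0$: on the set $\{(\mathbf{x},\dot{\mathbf{x}}):V(t)\le V(0)<p\psi(r)\}$, for every $(i,j)\in\mathcal{E}(0)$ and componentwise, $$\boldsymbol{\zeta}\big(\nabla_i\psi(|\mathbf{x}_{ij}|)-\nabla_i\psi(|\mathbf{x}^d_{ij}|)\big)\le\gamma\,\boldsymbol{\zeta}(\mathbf{x}_j-\mathbf{x}_{jd})+\eta\,\bar{x}_j\,\mathbf{1}$$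 for bounded $\boldsymbol{\zeta}(\mathbf{x}_{ij})$ and $\boldsymbol{\zeta}(\mathbf{x}^d_{ij})$, where $\boldsymbol{\zeta}(\mathbf{x})=(|x_1|,\dots,|x_n|)^{\mathsf T}$, $\bar{x}_j=\|\mathbf{x}_j-\mathbf{x}_{jd}\|_\infty$ and $\mathbf{1}=(1,\dots,1)^{\mathsf T}$.
   Formalization: Delayed positions before time 0 are undefined in the text; each agent is taken to rest at its initial position for t ≤ 0 (the claim fails for arbitrary histories). Revolute joints are read as 2π-periodic M_i, C_i, with M_i differentiable and C_i continuous; a classical solution exists for all t ≥ 0. *)

(* Defs.v *)
From HB Require Import structures.
From mathcomp Require Export all_boot all_order all_algebra.
From mathcomp Require Export all_classical all_reals all_analysis.

Set Implicit Arguments.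
Unset Strict Implicit.
Unset Printing Implicit Defensive.

Export Order.TTheory GRing.Theory Num.Theory.
Export numFieldNormedType.Exports.

Local Open Scope classical_set_scope.
Local Open Scope ring_scope.

(* Not the library norm `|z|, which is the sup norm on 'cV[R]_n. *)
Definition enorm (R : realType) (n : nat) (z : 'cV[R]_n) : R :=
  Num.sqrt (\sum_(k < n) z k 0 ^+ 2).

Definition qform (R : realType) (n : nat) (A : 'M[R]_n) (z : 'cV[R]_n) : R :=
  (z^T *m A *m z) 0 0.

Definition loewner_le (R : realType) (n : nat) (A B : 'M[R]_n) : Prop :=
  forall z : 'cV[R]_n, qform A z <= qform B z.

Definition skew_symmetric (R : realType) (n : nat) (A : 'M[R]_n) : Prop :=
  A^T = - A.

(* Joint coordinates of revolute joints are angles, so a quantity depending on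
   the configuration is unchanged by a full turn of any joint. *)
Definition revolute (R : realType) (n : nat) (T : Type)
    (F : 'cV[R]_n -> T) : Prop :=
  forall (q : 'cV[R]_n) (k : 'I_n),
    F (q + (2 * pi) *: delta_mx k 0) = F q.

(* [M q] is the inertia matrix at configuration q, [C q w] the matrix of
   Coriolis and centrifugal effects at configuration q and velocity w.  The
   directional derivative 'D_w M q is the rate of change of the inertia matrix
   along a motion passing through q with velocity w. *)
Record EL_properties (R : realType) (n : nat) (M : 'cV[R]_n -> 'M[R]_n)
    (C : 'cV[R]_n -> 'cV[R]_n -> 'M[R]_n) (lam1 lam2 : R) : Prop := {
  inertia_differentiable : forall q, differentiable M q;
  coriolis_continuous :
    continuous (fun qw : 'cV[R]_n * 'cV[R]_n => C qw.1 qw.2);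
  inertia_revolute : revolute M;
  coriolis_revolute : forall w, revolute (C ^~ w);
  inertia_symmetric : forall q, (M q)^T = M q;
  inertia_lower_gt0 : 0 < lam1;
  inertia_lower : forall q, loewner_le lam1%:M (M q);
  inertia_upper : forall q, loewner_le (M q) lam2%:M;
  inertia_coriolis_skew :
    forall q w, skew_symmetric ('D_w M q - 2 *: C q w) }.

(* Position x, velocity v and acceleration a of one agent moving from t = 0.
   Delayed positions refer to x at negative times as well: the agent is taken
   to have rested at its initial position before t = 0.  The initial velocity
   v 0 need not vanish; it is the right derivative of x at 0. *)
Record motion (R : realType) (n : nat) (x v a : R -> 'cV[R]_n) : Prop := {
  motion_history : forall s : R, s <= 0 -> x s = x 0;
  motion_continuous : {within `[0, +oo[, continuous x};
  motion_velocity_continuous : {within `[0, +oo[, continuous v};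
  motion_velocity : forall t : R, 0 < t -> is_derive t 1 x (v t);
  motion_acceleration : forall t : R, 0 < t -> is_derive t 1 v (a t) }.

Definition smallest_eigenvalue (R : realType) (n : nat) (A : 'M[R]_n)
    (k : R) : Prop :=
  eigenvalue A k /\ forall l : R, eigenvalue A l -> k <= l.

Definition psi (R : realType) (r Q s : R) : R :=
  s ^+ 2 / (r ^+ 2 - s ^+ 2 + Q).

(* The gradient of psi(|x_i - x_j|) with respect to x_i, as a function of
   z = x_i - x_j. *)
Definition grad_psi (R : realType) (n : nat) (r Q : R) (z : 'cV[R]_n) :
    'cV[R]_n :=
  (2 * (r ^+ 2 + Q) / (r ^+ 2 - enorm z ^+ 2 + Q) ^+ 2) *: z.

(* Position of agent j as received by agent i at time t; [d j i] is the delay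
   from j to i. *)
Definition delayed (R : realType) (n N : nat) (x : 'I_N -> R -> 'cV[R]_n)
    (d : 'I_N -> 'I_N -> R -> R) (i j : 'I_N) (t : R) : 'cV[R]_n :=
  x j (t - d j i t).

(* The neighbours of i are the j with E i j. *)
Definition control_torque (R : realType) (n N : nat) (r Q p : R)
    (E : rel 'I_N) (K : 'I_N -> 'M[R]_n) (g : 'I_N -> 'cV[R]_n -> 'cV[R]_n)
    (d : 'I_N -> 'I_N -> R -> R) (x v : 'I_N -> R -> 'cV[R]_n)
    (i : 'I_N) (t : R) : 'cV[R]_n :=
  - (p *: \sum_(j < N | E i j) grad_psi r Q (x i t - delayed x d i j t))
  - K i *m v i t + g i (x i t).

Definition energy (R : realType) (n N : nat) (r Q p : R) (E : rel 'I_N)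
    (M : 'I_N -> 'cV[R]_n -> 'M[R]_n) (x v : 'I_N -> R -> 'cV[R]_n)
    (t : R) : R :=
  1 / 2 * \sum_(i < N) qform (M i (x i t)) (v i t) +
  p / 2 * \sum_(i < N) \sum_(j < N | E i j) psi r Q (enorm (x i t - x j t)).

(* The first norm is the absolute value of a component, the second the sup
   norm of the displacement of agent j over the delay. *)
Definition gradient_mismatch (R : realType) (n N : nat) (r Q p : R)
    (E : rel 'I_N) (M : 'I_N -> 'cV[R]_n -> 'M[R]_n)
    (d : 'I_N -> 'I_N -> R -> R) (x v : 'I_N -> R -> 'cV[R]_n)
    (gamma eta : R) : Prop :=
  forall t : R, 0 <= t ->
    energy r Q p E M x v t <= energy r Q p E M x v 0 ->
    energy r Q p E M x v 0 < p * psi r Q r ->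
    forall i j : 'I_N, E i j -> forall k : 'I_n,
      `|(grad_psi r Q (x i t - x j t)
         - grad_psi r Q (x i t - delayed x d i j t)) k 0|
      <= gamma * `|(x j t - delayed x d i j t) k 0|
         + eta * `|x j t - delayed x d i j t|.

(* Main.v *)
Require Import Defs.
From mathcomp Require Import ring lra.

(* Along the motion the energy V satisfies
     V' = - sum_i x_i'^T K_i x_i' + p sum_(i,j) x_i'^T (grad psi(x_ij) - grad psi(x_ij^d)),
   where the Coriolis term disappears by skew-symmetry.  Young's inequality and
   the Cauchy-Schwarz bound |x_j - x_jd|^2 <= dbar * int_(t-dbar)^t |x_j'|^2 turn
   the gain condition into
     V(t) + sum_i c_i int_0^t |x_i'|^2 <= V(0)   with c_i > 0,                (1)
   as long as V <= V(0) and the links are kept up to t.  This region is never left.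
   Once some agent has moved, (1) gives V < V(0), hence a little more time; while
   nothing has moved, the mismatch bound cannot be used beyond t, but the delays
   are effectively as short as the time elapsed since the start of the motion, and
   local Lipschitz continuity of grad psi then yields V <= V(0) for a short time.
   V(t) <= V(0) < p psi(r) keeps the links.

   By (1) the velocities are square integrable and bounded.  The Coriolis matrix
   is bounded, being periodic in the configuration, so accelerations are bounded
   and velocities tend to 0 (Barbalat).  Differentiating the momenta,
     (M_i x_i')' = - f_i + o(1),   f_i = p sum_j grad psi(x_ij),
   because M_i' = C_i + C_i^T; the delays need not be continuous, but f_i is
   Lipschitz, so f_i tends to 0 by a second Barbalat argument.  Finally
   sum_i <x_i - x_0, f_i> dominates sum |x_ij|^2 over the edges. *)

Set Implicit Arguments.
Unset Strict Implicit.
Unset Printing Implicit Defensive.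

Local Open Scope classical_set_scope.
Local Open Scope ring_scope.

(** * Derivatives, mean value bounds and induction on the half-line *)

Section Calculus.
Variable R : realType.
Implicit Types (f g F : R -> R) (a b : R).

Lemma is_derive_cst_pt (c t : R) : is_derive t 1 (fun _ => c) 0.
Proof. exact: is_derive_cst. Qed.

Lemma is_deriveD_pt f g (t : R) df dg : is_derive t 1 f df -> is_derive t 1 g dg ->
  is_derive t 1 (fun s => f s + g s) (df + dg).
Proof. exact: is_deriveD. Qed.

Lemma is_deriveB_pt f g (t : R) df dg : is_derive t 1 f df -> is_derive t 1 g dg ->
  is_derive t 1 (fun s => f s - g s) (df - dg).
Proof. exact: is_deriveB. Qed.

Lemma is_deriveM_pt f g (t : R) df dg : is_derive t 1 f df -> is_derive t 1 g dg ->
  is_derive t 1 (fun s => f s * g s) (df * g t + f t * dg).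
Proof.
move=> hf hg; apply: (is_derive_eq (is_deriveM hf hg)).
by rewrite addrC; congr (_ + _); exact: mulrC.
Qed.

Lemma is_deriveMc_pt c f (t : R) df : is_derive t 1 f df ->
  is_derive t 1 (fun s => c * f s) (c * df).
Proof. exact: is_deriveZ. Qed.

Lemma is_deriveX2_pt f (t : R) df : is_derive t 1 f df ->
  is_derive t 1 (fun s => f s ^+ 2) (2 * (f t * df)).
Proof.
move=> hf; have -> : 2 * (f t * df) = df * f t + f t * df by ring.
exact: (is_deriveM_pt hf hf).
Qed.

Lemma is_derive_div_pt f g (t : R) df dg : g t != 0 ->
  is_derive t 1 f df -> is_derive t 1 g dg ->
  is_derive t 1 (fun s => f s / g s) ((df * g t - f t * dg) / g t ^+ 2).
Proof.
move=> g0 hf hg.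
have hV : is_derive t 1 (fun s => (g s)^-1) (- (g t) ^- 2 *: dg).
  split; first by apply: derivableV => //; case: hg.
  by rewrite deriveV// ?derive_val//; case: hg.
apply: (is_derive_eq (is_deriveM_pt hf hV)).
by rewrite /GRing.scale /=; field.
Qed.

Lemma is_derive_bigsum (I : Type) (r : seq I) (P : pred I) (h : I -> R -> R)
    (dh : I -> R) (t : R) :
  (forall i, P i -> is_derive t 1 (h i) (dh i)) ->
  is_derive t 1 (fun s => \sum_(i <- r | P i) h i s) (\sum_(i <- r | P i) dh i).
Proof.
move=> hh; elim: r => [|i r IH].
  rewrite big_nil (_ : (fun _ => _) = cst 0); last first.
    by apply/funext => s; rewrite big_nil.
  exact: is_derive_cst.
rewrite big_cons; case: ifP => Pi.
  rewrite (_ : (fun _ => _) = fun s => h i s + \sum_(i <- r | P i) h i s).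
    exact: is_deriveD_pt (hh i Pi) IH.
  by apply/funext => s; rewrite big_cons Pi.
by rewrite (_ : (fun _ => _) = fun s => \sum_(i <- r | P i) h i s)//;
  apply/funext => s; rewrite big_cons Pi.
Qed.

Lemma is_derive_continuous_pt f (t : R) df :
  is_derive t 1 f df -> {for t, continuous f}.
Proof.
by move=> [hf _]; apply: differentiable_continuous; exact/derivable1_diffP.
Qed.

Lemma is_derive_eq_right f g a (t : R) df : a < t ->
  (forall s, a < s -> f s = g s) -> is_derive t 1 f df -> is_derive t 1 g df.
Proof.
move=> at_ fg hf; apply: near_eq_is_derive hf => //.
by near=> s; apply: fg; near: s; exact: lt_nbhsr.
Unshelve. all: by end_near. Qed.

Lemma continuous_bigsum (T : topologicalType) (I : Type) (r : seq I)
    (P : pred I) (h : I -> T -> R) (t : T) :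
  (forall i, P i -> {for t, continuous (h i)}) ->
  {for t, continuous (fun s : T => \sum_(i <- r | P i) h i s)}.
Proof.
move=> hh; elim: r => [|i r IH].
  rewrite (_ : (fun _ => _) = cst 0); last first.
    by apply/funext => s; rewrite big_nil.
  exact: cst_continuous.
rewrite (_ : (fun _ => _) =
    fun s => (if P i then h i s else 0) + \sum_(i <- r | P i) h i s).
  apply: continuousD IH.
  by case: (boolP (P i)) => [/hh//|_]; exact: cst_continuous.
by apply/funext => s; rewrite big_cons; case: ifP; rewrite ?add0r.
Qed.

Lemma le_of_deriv_le0 f df a b : a <= b ->
  (forall t, a <= t <= b -> {for t, continuous f}) ->
  (forall t, a < t < b -> is_derive t 1 f (df t)) ->
  (forall t, a < t < b -> df t <= 0) -> f b <= f a.
Proof.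
rewrite le_eqVlt => /predU1P[->//|ab] cf hf df0.
have hf' (t : R) : t \in `]a, b[ -> is_derive t 1 f (df t).
  by rewrite in_itv; exact: hf.
have cf' : {within `[a, b], continuous f}.
  by apply: continuous_in_subspaceT => t; rewrite inE/= in_itv; exact: cf.
have [t] := MVT ab hf' cf'.
rewrite in_itv/= => tab E; rewrite -subr_le0 E.
by rewrite mulr_le0_ge0 ?df0// subr_ge0 ltW.
Qed.

Lemma dist_le_of_deriv f df B a b : a <= b ->
  (forall t, a <= t <= b -> {for t, continuous f}) ->
  (forall t, a < t < b -> is_derive t 1 f (df t)) ->
  (forall t, a < t < b -> `|df t| <= B) -> `|f b - f a| <= B * (b - a).
Proof.
rewrite le_eqVlt => /predU1P[->|ab] cf hf dfB; first by rewrite !subrr mulr0 normr0.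
have hf' (t : R) : t \in `]a, b[ -> is_derive t 1 f (df t).
  by rewrite in_itv; exact: hf.
have cf' : {within `[a, b], continuous f}.
  by apply: continuous_in_subspaceT => t; rewrite inE/= in_itv; exact: cf.
have [t] := MVT ab hf' cf'.
rewrite in_itv/= => tab ->; rewrite normrM (gtr0_norm (x := b - a)) ?subr_gt0//.
by rewrite ler_wpM2r ?dfB// subr_ge0 ltW.
Qed.

(** The fundamental theorem is applied to the integral from [a], so the derivative is claimed only
    to the right of [a]; callers take [a] below the interval of interest. *)
Lemma continuous_antiderivative f a : continuous f ->
  exists F, forall t, a < t -> is_derive t 1 F (f t).
Proof.
move=> cf; exists (fun t => (\int[lebesgue_measure]_(s in `[a, t]) f s)%R).
move=> t at_; have [||||dF Ff] := @continuous_FTC1_closed R f a t (t + 1).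
- by rewrite ltrDl.
- apply: continuous_compact_integrable; first exact: segment_compact.
  exact: continuous_subspaceT.
- exact: at_.
- exact: cf.
- by apply: DeriveDef; [exact: dF|rewrite -derive1E; exact: Ff].
Qed.

(** The infimum of the counterexamples is a point where [P] still holds, by the first two
    hypotheses, so the third pushes the counterexamples further to the right, a contradiction. *)
Lemma real_induction (P : R -> Prop) :
  P 0 ->
  (forall t, 0 < t -> (forall s, 0 <= s < t -> P s) -> P t) ->
  (forall t, 0 <= t -> (forall s, 0 <= s <= t -> P s) ->
    exists2 e, 0 < e & forall s, t < s < t + e -> P s) ->
  forall t, 0 <= t -> P t.
Proof.
move=> P0 Pcl Pop; apply: contrapT => /existsNP[b /not_implyP[b0 nPb]].
pose A := [set t | 0 <= t /\ ~ P t].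
have Ab : A b by [].
have hA : has_inf A by split; [exists b|exists 0 => y []].
have m0 : 0 <= inf A by apply: lb_le_inf; [exists b|move=> y []].
have Plt s : 0 <= s < inf A -> P s.
  move=> /andP[s0 sA]; apply: contrapT => nPs.
  by have := ge_inf hA.2 (conj s0 nPs); rewrite leNgt sA.
have Pm : P (inf A).
  by move: m0; rewrite le_eqVlt => /predU1P[<-//|m0]; exact: Pcl.
have [s|e e0 Pe] := Pop _ m0.
  move=> /andP[s0]; rewrite le_eqVlt => /predU1P[->//|sA].
  by apply: Plt; rewrite s0.
have [c [c0 nPc] cA] := inf_adherent e0 hA.
have := ge_inf hA.2 (conj c0 nPc); rewrite le_eqVlt => /predU1P[E|Ac].
  by apply: nPc; rewrite -E.
by apply: nPc; apply: Pe; rewrite Ac.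
Qed.

End Calculus.

(** * Integrals of squared speed, Cauchy-Schwarz and Barbalat's lemma *)

Section Energy_integrals.
Variable R : realType.
Implicit Types (u x F G H q f e : R -> R) (s t : R).

Lemma continuous_maxr0 : continuous (fun t : R => Num.max t 0).
Proof. by move=> t; apply: continuous_max; [exact: cvg_id|exact: cst_continuous]. Qed.

(** The primitive is 0 at negative times, in keeping with agents at rest before 0, so windows
    reaching into the past need no separate treatment. *)
Lemma primitive_from0 u : continuous u -> (forall t, 0 <= u t) ->
  exists F, [/\ forall t, t <= 0 -> F t = 0, continuous F,
    forall t, 0 < t -> is_derive t 1 F (u t) & {homo F : s t / s <= t}].
Proof.
(* Starting at [-1] instead of 0 makes [G] continuous at 0 itself. *)
move=> cu u0; have [G hG] := continuous_antiderivative (-1) cu.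
have cG t : 0 <= t -> {for t, continuous G}.
  by move=> t0; apply: is_derive_continuous_pt (hG t _); apply: lt_le_trans t0; lra.
have hF t : 0 < t -> is_derive t 1 (fun t => G (Num.max t 0) - G 0) (u t).
  move=> t0; apply: (@is_derive_eq_right _ (fun t => G t - G 0) _ 0) => //.
    by move=> s s0; rewrite max_l// ltW.
  rewrite -[u t]subr0; apply: is_deriveB_pt.
  by apply: hG; lra.
exists (fun t => G (Num.max t 0) - G 0).
have cF : continuous (fun t => G (Num.max t 0) - G 0).
  move=> t; apply: continuousB; last exact: cst_continuous.
  apply: (@continuous_comp _ _ _ (fun t => Num.max t 0) G).
    exact: continuous_maxr0.
  by apply: cG; rewrite le_max lexx orbT.
split => //.
- by move=> t t0; rewrite max_r// subrr.
- move=> s t st; rewrite lerB//; set a := Num.max s 0; set b := Num.max t 0.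
  have ab : a <= b by rewrite ge_max !le_max st lexx orbT.
  have a0 : 0 <= a by rewrite le_max lexx orbT.
  rewrite -lerN2; apply: (@le_of_deriv_le0 R (fun t => - G t) (fun t => - u t) a b) => //.
  + move=> z /andP[az _]; apply: continuousN; apply: cG; exact: le_trans az.
  + move=> z /andP[az _]; apply: is_deriveN; apply: hG; lra.
  + by move=> z _; rewrite oppr_le0.
Qed.

(* [H t] is the integral of [F] over [[t - h, t]]. *)
Lemma window_integral F (h : R) : 0 <= h ->
  (forall t, t <= 0 -> F t = 0) -> continuous F -> {homo F : s t / s <= t} ->
  exists H, [/\ H 0 = 0, forall t, 0 <= t -> {for t, continuous H},
    forall t, 0 <= t -> is_derive t 1 H (F t - F (t - h)) &
    forall t, 0 <= t -> H t <= h * F t].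
Proof.
move=> h0 F0 cF mF; have [G hG] := continuous_antiderivative (- h - 1) cF.
have cG t : - h <= t -> {for t, continuous G}.
  by move=> t0; apply: is_derive_continuous_pt (hG t _); lra.
have G0 : G (- h) = G 0.
  apply/eqP; rewrite eq_sym -subr_eq0 -normr_le0.
  rewrite -[leRHS](mul0r (0 - (- h))).
  apply: (@dist_le_of_deriv R G F) => [|t /andP[? _]|t /andP[? _]|t /andP[_ ?]].
  - lra.
  - exact: cG.
  - by apply: hG; lra.
  - by rewrite F0 ?normr0// ltW.
have hH t : 0 <= t -> is_derive t 1 (fun t => G t - G (t - h)) (F t - F (t - h)).
  move=> t0; apply: is_deriveB_pt; first by apply: hG; lra.
  have := hG (t - h) _.
  have /[swap]/[apply] : - h - 1 < t - h by lra.
  move=> [dG vG].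
  have hs : is_derive t 1 (fun t => t - h) 1.
    by rewrite -[X in is_derive _ _ _ X]subr0; apply: is_deriveB_pt; exact: is_derive_cst_pt.
  have := @is_derive1_comp R G (fun t => t - h) t (F (t - h)) 1 (DeriveDef dG vG) hs.
  by rewrite mulr1.
exists (fun t => G t - G (t - h)); split => //.
- by rewrite sub0r G0 subrr.
- by move=> t t0; exact: is_derive_continuous_pt (hH t t0).
- move=> t t0; rewrite -lerN2 opprB.
  have -> : G (t - h) - G t = (G (t - h) + F t * (t - h)) - (G t + F t * (t - h)) by ring.
  (* As [F] is nondecreasing, [G s - F t * s] has derivative [F s - F t <= 0] on the window. *)
  suff : (fun s => G s - F t * s) t <= (fun s => G s - F t * s) (t - h) by move=> /=; lra.
  apply: (@le_of_deriv_le0 R (fun s => G s - F t * s) (fun s => F s - F t * 1)) => [|s /andP[? ?]|s /andP[? ?]|s /andP[_ ?]].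
  - lra.
  - apply: continuousB; first by apply: cG; lra.
    by apply: continuousM; [exact: cst_continuous|exact: cvg_id].
  - apply: is_deriveB_pt; first by apply: hG; lra.
  - by rewrite mulr1 subr_le0 mF// ltW.
Qed.

(* The optimal choice is [l := D / A]. *)
Lemma sqr_le_of_weighted_mean (D A B : R) : 0 <= D -> 0 <= A -> 0 <= B ->
  (forall l, 0 < l -> D <= l / 2 * A + B / (2 * l)) -> D ^+ 2 <= B * A.
Proof.
rewrite le_eqVlt => /predU1P[<-|D0] A0 B0 hl.
  by rewrite expr0n /= mulr_ge0.
have [AE|A1] := eqVneq A 0.
  have [BE|B1] := eqVneq B 0.
    have := hl 1 ltr01; rewrite AE BE; lra.
  have Bp : 0 < B by rewrite lt_neqAle eq_sym B1.
  (* With [A = 0] the weight [B / D] gives [D <= D / 2], against [0 < D]. *)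
  have := hl (B / D) (divr_gt0 Bp D0); rewrite AE mulr0 add0r.
  have -> : B / (2 * (B / D)) = D / 2 by field; rewrite B1 gt_eqF.
  lra.
have Ap : 0 < A by rewrite lt_neqAle eq_sym A1.
have := hl (D / A) (divr_gt0 D0 Ap).
have -> : D / A / 2 * A + B / (2 * (D / A)) = D / 2 + B * A / (2 * D).
  by field; rewrite A1 gt_eqF.
move=> h; have : D * D <= (D / 2 + B * A / (2 * D)) * D by rewrite ler_pM2r.
have -> : (D / 2 + B * A / (2 * D)) * D = D * D / 2 + B * A / 2.
  by field; rewrite gt_eqF.
by rewrite expr2; lra.
Qed.

(** Cauchy-Schwarz for the displacement as an integral of [u], obtained without integrals: Young's
    inequality for a fixed weight [l] becomes the monotonicity of an auxiliary function, and [l] is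
    optimized afterwards. *)
Lemma sqr_displacement_le x u F : continuous x ->
  (forall t, t <= 0 -> x t = x 0) -> (forall t, 0 < t -> is_derive t 1 x (u t)) ->
  (forall t, t <= 0 -> F t = 0) -> continuous F -> {homo F : s t / s <= t} ->
  (forall t, 0 < t -> is_derive t 1 F (u t ^+ 2)) ->
  forall s t, s <= t -> (x t - x s) ^+ 2 <= (t - s) * (F t - F s).
Proof.
move=> cx x0 dx F0 cF mF dF.
have key s t : 0 <= s -> s <= t -> (x t - x s) ^+ 2 <= (t - s) * (F t - F s).
  move=> s0 st; rewrite -(real_normK (num_real _)); apply: sqr_le_of_weighted_mean => //.
  - by rewrite subr_ge0 mF.
  - by rewrite subr_ge0.
  move=> l l0.
  (* Here [c] is the sign 1 or -1 that resolves the absolute value; the derivative of [y] is minus a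
     square because [c ^+ 2 = 1]. *)
  have aux (c : R) : c ^+ 2 = 1 -> c * (x t - x s) <= l / 2 * (F t - F s) + (t - s) / (2 * l).
    move=> c1; pose y z := c * x z - l / 2 * F z - (2 * l)^-1 * z.
    suff : y t <= y s.
      rewrite /y => h; rewrite [(t - s) / _]mulrC; move: h; set w := (2 * l)^-1.
      lra.
    apply: (@le_of_deriv_le0 R y (fun z => c * u z - l / 2 * u z ^+ 2 - (2 * l)^-1 * 1)) => //.
    - move=> z _; apply: continuousB; first apply: continuousB.
      + by apply: continuousM; [exact: cst_continuous|exact: cx].
      + by apply: continuousM; [exact: cst_continuous|exact: cF].
      + by apply: continuousM; [exact: cst_continuous|exact: cvg_id].
    - move=> z /andP[sz _]; have z0 : 0 < z by exact: le_lt_trans sz.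
      apply: is_deriveB_pt.
      by apply: is_deriveB_pt; apply: is_deriveMc_pt; [exact: dx|exact: dF].
    - move=> z _; set w := u z.
      have -> : c * w - l / 2 * w ^+ 2 - (2 * l)^-1 * 1 = - (l / 2) * (w - c / l) ^+ 2.
        have -> : (w - c / l) ^+ 2 = w ^+ 2 - 2 * w * c / l + c ^+ 2 / l ^+ 2.
          by field; rewrite gt_eqF.
        by rewrite c1; field; rewrite gt_eqF.
      by rewrite mulNr oppr_le0 mulr_ge0 ?sqr_ge0// divr_ge0 ?ltW.
  case: (ger0P (x t - x s)) => _.
    by rewrite -[leLHS]mul1r aux ?expr1n.
  by rewrite -mulN1r aux ?sqrrN ?expr1n.
(* Both [x] and [F] are constant at negative times, so a negative [s] can be moved to 0, which only
   shortens the interval. *)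
move=> s t st; have [s0|s0] := leP 0 s; first exact: key.
have [t0|t0] := leP t 0.
  by rewrite (x0 t)// (x0 s) ?(ltW s0)// subrr expr0n /= mulr_ge0// subr_ge0// mF.
rewrite (x0 s) ?(ltW s0)//; have -> : F s = F 0 by rewrite !F0// ltW.
apply: (le_trans (key 0 t _ _)) => //; first exact: ltW.
rewrite ler_wpM2r ?subr_ge0 ?mF ?(ltW t0)//; lra.
Qed.

(** If [|f t|] exceeds [eps] at a late time, the Lipschitz bound keeps it above [3 eps / 4] with the
    same sign for a time [h]. With [|e| <= eps / 4] this moves [q] by at least [eps * h / 2],
    whereas [|q| <= eps * h / 8] allows only half of that. No continuity of [e] enters. *)
Lemma barbalat_perturbed q f e (L : R) :
  (forall t, 0 < t -> is_derive t 1 q (e t - f t)) ->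
  (forall s t, 0 < s -> s <= t -> `|f t - f s| <= L * (t - s)) ->
  q t @[t --> +oo] --> (0 : R) -> e t @[t --> +oo] --> (0 : R) ->
  f t @[t --> +oo] --> (0 : R).
Proof.
move=> dq Lf q0 e0.
pose L' := `|L| + 1.
have L'0 : 0 < L' by rewrite ltr_wpDl.
have Lf' s t : 0 < s -> s <= t -> `|f t - f s| <= L' * (t - s).
  move=> s0 st; apply: le_trans (Lf s t s0 st) _; rewrite ler_wpM2r ?subr_ge0//.
  by rewrite /L' (le_trans (ler_norm L))// lerDl.
apply/cvgr0Pnorm_le => eps eps0.
pose h := eps / (4 * L').
have h0 : 0 < h by rewrite divr_gt0// mulr_gt0.
have hL : L' * h = eps / 4 by rewrite /h; field; rewrite gt_eqF.
have eh0 : 0 < eps * h / 8 by rewrite divr_gt0// mulr_gt0.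
have [T1 [_ hT1]] : \forall t \near +oo, `|q t| <= eps * h / 8 by exact: cvgr0_norm_le.
have [T2 [_ hT2]] : \forall t \near +oo, `|e t| <= eps / 4.
  by apply: cvgr0_norm_le => //; rewrite divr_gt0.
exists (Num.max (Num.max T1 T2) 0); split; first exact: num_real.
move=> t /=; rewrite !gt_max => /andP[/andP[tT1 tT2] t0].
rewrite leNgt; apply/negP => ft.
have cq s : 0 < s -> {for s, continuous q}.
  by move=> s0; exact: is_derive_continuous_pt (dq s s0).
have qt := hT1 t tT1.
have qth : `|q (t + h)| <= eps * h / 8 by apply: hT1 => /=; lra.
have ef s : t < s < t + h -> `|e s| <= eps / 4 /\ `|f s - f t| <= eps / 4.
  move=> /andP[ts sh]; split; first by apply: hT2 => /=; lra.
  apply: le_trans (Lf' t s t0 (ltW ts)) _; rewrite -hL ler_wpM2l ?(ltW L'0)//; lra.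
have D : 0 <= eps * h by apply: mulr_ge0; exact: ltW.
have Dp : 0 < eps * h by exact: mulr_gt0.
move: qt qth; rewrite !ler_norml => /andP[q1 q2] /andP[q3 q4].
have [f0|f0] := ltP 0 (f t).
  rewrite gtr0_norm// in ft.
  have : q (t + h) + eps / 2 * (t + h) <= q t + eps / 2 * t.
    apply: (@le_of_deriv_le0 R (fun s => q s + eps / 2 * s) (fun s => (e s - f s) + eps / 2 * 1)).
    - lra.
    - move=> s /andP[ts _]; apply: continuousD; first by apply: cq; lra.
      by apply: continuousM; [exact: cst_continuous|exact: cvg_id].
    - by move=> s /andP[ts _]; apply: is_deriveD_pt; apply: dq; lra.
    - move=> s /ef[]; rewrite !ler_norml => /andP[? ?] /andP[? ?]; lra.
  rewrite mulrDr; lra.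
rewrite ler0_norm// in ft.
have : - (q (t + h)) + eps / 2 * (t + h) <= - q t + eps / 2 * t.
  apply: (@le_of_deriv_le0 R (fun s => - q s + eps / 2 * s) (fun s => - (e s - f s) + eps / 2 * 1)).
  - lra.
  - move=> s /andP[ts _]; apply: continuousD; first by apply: continuousN; apply: cq; lra.
    by apply: continuousM; [exact: cst_continuous|exact: cvg_id].
  - by move=> s /andP[ts _]; apply: is_deriveD_pt; apply: is_deriveN; apply: dq; lra.
  - move=> s /ef[]; rewrite !ler_norml => /andP[? ?] /andP[? ?]; lra.
rewrite mulrDr; lra.
Qed.

Lemma nondecreasing_bounded_cvg F (B : R) : {homo F : s t / s <= t} ->
  (forall t, F t <= B) -> exists l : R, F t @[t --> +oo] --> l.
Proof.
move=> mF FB; exists (sup (range F)).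
apply: nondecreasing_cvgr => //; exists B => _ [t _ <-]; exact: FB.
Qed.

End Energy_integrals.

(** * Euclidean norm, gradient of the potential, quadratic forms *)

Section Norms.
Variables (R : realType) (n : nat).
Implicit Types (z w : 'cV[R]_n) (r Q : R).

(** Without the square root the quantity is a polynomial in the entries, differentiable at 0 too. *)
Definition sqnorm z : R := \sum_(k < n) z k 0 ^+ 2.

Lemma sqnorm_ge0 z : 0 <= sqnorm z.
Proof. by apply: sumr_ge0 => k _; exact: sqr_ge0. Qed.

Lemma sqr_enorm z : enorm z ^+ 2 = sqnorm z.
Proof. by rewrite /enorm sqr_sqrtr// sqnorm_ge0. Qed.

Lemma sqnormN z : sqnorm (- z) = sqnorm z.
Proof. by apply: eq_bigr => k _; rewrite mxE sqrrN. Qed.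

Lemma enorm_ltr z r : 0 < r -> (enorm z < r) = (sqnorm z < r ^+ 2).
Proof.
move=> r0; rewrite -sqr_enorm ltr_pXn2r// ?nnegrE ?sqrtr_ge0//; exact: ltW.
Qed.

Lemma mx_entry_le p q (A : 'M[R]_(p, q)) i j : `|A i j| <= `|A|.
Proof.
rewrite [leRHS]/Num.Def.normr/= mx_normrE.
exact: (le_bigmax _ (fun ij => `|A ij.1 ij.2|) (i, j)).
Qed.

Lemma mx_norm_le p q (A : 'M[R]_(p, q)) (c : R) : 0 <= c ->
  (forall i j, `|A i j| <= c) -> `|A| <= c.
Proof.
by move=> c0 Ac; rewrite [leLHS]/Num.Def.normr/= mx_normrE; exact: bigmax_le.
Qed.

Lemma cV_norm_le z (c : R) : 0 <= c -> (forall k, `|z k 0| <= c) -> `|z| <= c.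
Proof. by move=> c0 h; apply: mx_norm_le => // i j; rewrite ord1. Qed.

Lemma sqr_entry_le_sqnorm z k : z k 0 ^+ 2 <= sqnorm z.
Proof.
rewrite /sqnorm (bigD1 k)//= lerDl.
by apply: sumr_ge0 => i _; exact: sqr_ge0.
Qed.

Lemma sqr_norm_le_sqnorm z : `|z| ^+ 2 <= sqnorm z.
Proof.
rewrite -sqr_enorm ler_pXn2r// ?nnegrE ?sqrtr_ge0//.
apply: cV_norm_le => [|k]; first exact: sqrtr_ge0.
rewrite -(ler_pXn2r (n := 2))// ?nnegrE ?sqrtr_ge0//.
by rewrite sqr_enorm real_normK ?num_real// sqr_entry_le_sqnorm.
Qed.

Lemma grad_psiE r Q z k : grad_psi r Q z k 0 =
  2 * (r ^+ 2 + Q) / (r ^+ 2 + Q - sqnorm z) ^+ 2 * z k 0.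
Proof. by rewrite /grad_psi mxE sqr_enorm addrAC. Qed.

Lemma grad_psiN r Q z k : grad_psi r Q (- z) k 0 = - grad_psi r Q z k 0.
Proof. by rewrite !grad_psiE sqnormN mxE mulrN. Qed.

Lemma grad_psi_swap r Q z w k :
  grad_psi r Q (w - z) k 0 = - grad_psi r Q (z - w) k 0.
Proof. by rewrite -opprB grad_psiN. Qed.

Lemma psi_enormE r Q z :
  psi r Q (enorm z) = sqnorm z / (r ^+ 2 + Q - sqnorm z).
Proof. by rewrite /psi sqr_enorm addrAC. Qed.

Lemma psi_den_gt0 r Q z : 0 < Q -> sqnorm z <= r ^+ 2 ->
  0 < r ^+ 2 + Q - sqnorm z.
Proof. by set S := sqnorm z => Q0 zr; lra. Qed.

Lemma norm_entry_le r z k : 0 < r -> sqnorm z <= r ^+ 2 -> `|z k 0| <= r.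
Proof.
move=> r0 zr; rewrite -(ler_pXn2r (n := 2))// ?nnegrE ?(ltW r0)//.
by rewrite real_normK ?num_real// (le_trans (sqr_entry_le_sqnorm z k)).
Qed.

Lemma sqnormB_le r z w : 0 < r -> sqnorm z <= r ^+ 2 -> sqnorm w <= r ^+ 2 ->
  `|sqnorm z - sqnorm w| <= n%:R * (2 * r) * `|z - w|.
Proof.
move=> r0 zr wr; rewrite /sqnorm -sumrB.
apply: (le_trans (ler_norm_sum _ _ _)).
have -> : n%:R * (2 * r) * `|z - w| = \sum_(k < n) 2 * r * `|z - w|.
  by rewrite sumr_const card_ord -mulr_natl; ring.
apply: ler_sum => k _.
rewrite subr_sqr normrM mulrC ler_pM//.
  apply: (le_trans (ler_normD _ _)).
  by have := norm_entry_le k r0 zr; have := norm_entry_le k r0 wr; lra.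
by have := mx_entry_le (z - w) k 0; rewrite !mxE.
Qed.

(** On the closed ball of radius [r] the base of the squared denominator is at least [Q], so [Q > 0]
    keeps the gradient away from its pole. *)
Lemma grad_psi_lipschitz r Q : 0 < r -> 0 < Q -> exists2 L, 0 < L &
  forall z w, sqnorm z <= r ^+ 2 -> sqnorm w <= r ^+ 2 ->
  forall k, `|(grad_psi r Q z - grad_psi r Q w) k 0| <= L * `|z - w|.
Proof.
move=> r0 Q0; pose c := r ^+ 2 + Q.
have c0 : 0 < c by rewrite addr_gt0// exprn_gt0.
have Q20 : 0 < Q ^+ 2 by rewrite exprn_gt0.
pose L1 := 2 * c / Q ^+ 2.
pose L2 := 2 * c * (2 * c) / (Q ^+ 2 * Q ^+ 2) * (n%:R * (2 * r)).
have L10 : 0 < L1 by rewrite divr_gt0// mulr_gt0.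
have L20 : 0 <= L2.
  apply: mulr_ge0; last by rewrite !mulr_ge0// ltW.
  by apply: divr_ge0; rewrite ltW// mulr_gt0// mulr_gt0.
exists (L1 + L2 * r) => [|z w zr wr k].
  by rewrite ltr_wpDr// mulr_ge0// ltW.
have denQ y : sqnorm y <= r ^+ 2 -> Q <= c - sqnorm y by rewrite /c; lra.
have den2 y : sqnorm y <= r ^+ 2 -> Q ^+ 2 <= (c - sqnorm y) ^+ 2.
  move=> /denQ h; rewrite ler_pXn2r// ?nnegrE ?(ltW Q0)//.
  exact: le_trans (ltW Q0) h.
have -> : (grad_psi r Q z - grad_psi r Q w) k 0 =
  grad_psi r Q z k 0 - grad_psi r Q w k 0 by rewrite !mxE.
rewrite !grad_psiE -/c; set a := sqnorm z; set b := sqnorm w.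
have a0 : 0 < (c - a) ^+ 2 by apply: lt_le_trans (den2 _ zr).
have b0 : 0 < (c - b) ^+ 2 by apply: lt_le_trans (den2 _ wr).
have dz : c - a != 0 by rewrite gt_eqF// (lt_le_trans _ (denQ _ zr)).
have dw : c - b != 0 by rewrite gt_eqF// (lt_le_trans _ (denQ _ wr)).
(* Separates the variation of the vector from that of its coefficient; the latter is proportional to
   [a - b], the difference of the squared norms. *)
have -> : 2 * c / (c - a) ^+ 2 * z k 0 - 2 * c / (c - b) ^+ 2 * w k 0 =
  2 * c / (c - a) ^+ 2 * (z k 0 - w k 0) +
  2 * c * (2 * c - a - b) / ((c - a) ^+ 2 * (c - b) ^+ 2) * (a - b) * w k 0.
  by field; rewrite ?dz ?dw.
apply: le_trans (ler_normD _ _) _; rewrite [leRHS]mulrDl lerD//.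
  rewrite normrM ler_pM//.
    rewrite ger0_norm ?divr_ge0 ?(ltW a0) ?mulr_ge0 ?(ltW c0)//.
    by rewrite ler_pM2l ?mulr_gt0// lef_pV2 ?posrE// den2.
  by have := mx_entry_le (z - w) k 0; rewrite !mxE.
rewrite [leRHS]mulrAC normrM ler_pM//; last first.
  exact: norm_entry_le.
rewrite normrM -[leRHS]mulrA ler_pM//; last exact: sqnormB_le.
have az := sqnorm_ge0 z; have bw := sqnorm_ge0 w.
have aQ := denQ _ zr; have bQ := denQ _ wr.
rewrite -/a -/b in az bw aQ bQ.
have cab : 0 <= 2 * c - a - b by lra.
have c2 : 0 < 2 * c by rewrite mulr_gt0.
have D0 := mulr_gt0 a0 b0; have num0 := mulr_ge0 (ltW c2) cab.
rewrite ger0_norm; last by rewrite divr_ge0// ltW.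
apply: ler_pM => //; first by rewrite invr_ge0 ltW.
  by rewrite ler_pM2l//; lra.
rewrite lef_pV2 ?posrE ?(mulr_gt0 Q20 Q20)//.
by apply: ler_pM; rewrite ?(ltW Q20)// den2.
Qed.

(** Young's inequality with weight [al] in each component. The [et] term brings the same sup norm
    into all [n] components, hence the factor [n%:R], while the [gam] terms add up to [sqnorm y].
    This is the origin of the shape of the gain condition. *)
Lemma inner_le_weighted (al gam et : R) (u y w : 'cV[R]_n) :
  0 < al -> 0 <= gam -> 0 <= et ->
  (forall l, `|w l 0| <= gam * `|y l 0| + et * `|y|) ->
  \sum_l u l 0 * w l 0 <= al * (gam + et) / 2 * sqnorm u
    + (gam + n%:R * et) / (2 * al) * sqnorm y.
Proof.
move=> al0 gam0 et0 wy; set m := `|y|.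
have young (b c : R) : b * c <= al / 2 * b ^+ 2 + (2 * al)^-1 * c ^+ 2.
  rewrite -subr_ge0.
  have -> : al / 2 * b ^+ 2 + (2 * al)^-1 * c ^+ 2 - b * c = al / 2 * (b - c / al) ^+ 2.
    by field; rewrite gt_eqF.
  by rewrite mulr_ge0 ?sqr_ge0// divr_ge0// ltW.
have sq (b : R) : `|b| ^+ 2 = b ^+ 2 by rewrite real_normK ?num_real.
apply: (@le_trans _ _ (\sum_l (gam * (al / 2 * u l 0 ^+ 2 + (2 * al)^-1 * y l 0 ^+ 2)
    + et * (al / 2 * u l 0 ^+ 2 + (2 * al)^-1 * m ^+ 2)))).
  apply: ler_sum => l _; apply: (le_trans (ler_norm _)); rewrite normrM.
  apply: (@le_trans _ _ (gam * (`|u l 0| * `|y l 0|) + et * (`|u l 0| * m))).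
    by rewrite [X in X + _]mulrCA [X in _ + X]mulrCA -mulrDr ler_wpM2l.
  by apply: lerD; apply: ler_wpM2l => //; rewrite (le_trans (young _ _))// !sq.
rewrite big_split /= -!mulr_sumr !big_split /= -!mulr_sumr sumr_const card_ord.
rewrite -!/(sqnorm _) -[m *+ n]mulr_natr -subr_ge0.
set su := sqnorm u; set sy := sqnorm y.
have -> : al * (gam + et) / 2 * su + (gam + n%:R * et) / (2 * al) * sy -
  (gam * (al / 2 * su + (2 * al)^-1 * sy) +
   et * (al / 2 * su + (2 * al)^-1 * (m * (m * n%:R)))) =
  n%:R * et / (2 * al) * (sy - m ^+ 2) by field; rewrite gt_eqF.
rewrite mulr_ge0 ?subr_ge0 ?sqr_norm_le_sqnorm//.
by rewrite divr_ge0 ?mulr_ge0// ltW.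
Qed.

Lemma qformE (A : 'M[R]_n) z :
  qform A z = \sum_(k < n) \sum_(l < n) z k 0 * A k l * z l 0.
Proof.
rewrite /qform !mxE exchange_big; apply: eq_bigr => l _ /=.
by rewrite !mxE mulr_suml; apply: eq_bigr => k _; rewrite !mxE.
Qed.

Lemma qform_scalar (c : R) z : qform c%:M z = c * sqnorm z.
Proof.
rewrite qformE mulr_sumr; apply: eq_bigr => k _.
rewrite (bigD1 k)//= big1 ?addr0 => [|l lk]; first by rewrite mxE eqxx mulr1n; ring.
by rewrite mxE eq_sym (negbTE lk) mulr0n mulr0 mul0r.
Qed.

(** Each diagonal entry of a diagonal matrix is an eigenvalue, with a unit row vector as
    eigenvector. *)
Lemma smallest_eigenvalue_le_diag (A : 'M[R]_n) (c : R) l :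
  is_diag_mx A -> smallest_eigenvalue A c -> c <= A l l.
Proof.
move=> /is_diag_mxP dA [_]; apply; apply/eigenvalueP.
exists (delta_mx 0 l); last first.
  by apply/eqP => /matrixP /(_ 0 l); rewrite !mxE !eqxx; exact/eqP/oner_neq0.
apply/rowP => j; rewrite !mxE (bigD1 l)//= big1 => [|i il].
  rewrite [in LHS]mxE !eqxx /= mul1r addr0; have [<-|jl] := eqVneq l j.
    by rewrite mulr1.
  by rewrite mulr0 dA.
by rewrite !mxE (negbTE il) andbF mul0r.
Qed.

Lemma diag_mulmx_entry (A : 'M[R]_n) z l :
  is_diag_mx A -> (A *m z) l 0 = A l l * z l 0.
Proof.
move=> /is_diag_mxP dA; rewrite mxE (bigD1 l)//= big1 ?addr0// => i il.
by rewrite dA ?mul0r// eq_sym.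
Qed.

End Norms.

(** Swapping the two ends of every edge turns the [w j] half into a copy of the [w i] half. Used
    with velocities for the derivative of the potential and with positions for the final
    estimate. *)
Lemma sum_antisymmetric (R : realFieldType) (I J : finType) (E : rel I)
    (G : I -> I -> J -> R) (w : I -> J -> R) :
  symmetric E -> (forall i j k, G j i k = - G i j k) ->
  \sum_i \sum_(j | E i j) \sum_k G i j k * (w i k - w j k) =
  2 * \sum_i \sum_(j | E i j) \sum_k w i k * G i j k.
Proof.
move=> symE antiG.
transitivity (\sum_i \sum_(j | E i j) \sum_k w i k * G i j k +
              \sum_i \sum_(j | E i j) \sum_k w j k * G j i k).
  rewrite -big_split; apply: eq_bigr => i _ /=.
  rewrite -big_split; apply: eq_bigr => j _ /=.
  by rewrite -big_split; apply: eq_bigr => k _ /=; rewrite antiG; ring.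
rewrite [X in _ + X](exchange_big_dep xpredT)//= mulr2n mulrDl mul1r.
congr (_ + _); apply: eq_bigr => j _; apply: eq_bigl => i.
by rewrite symE.
Qed.

(** * Derivatives of matrix-valued functions *)

Section Matrix_calculus.
Variables (R : realType).

Lemma is_derive_entry p q (A : R -> 'M[R]_(p, q)) (t : R) (dA : 'M[R]_(p, q)) i j :
  is_derive t 1 A dA -> is_derive t 1 (fun s => A s i j) (dA i j).
Proof.
move=> [hA <-]; apply: DeriveDef; first exact: (derivable_mxP A t 1).1.
by rewrite derive_mx// mxE.
Qed.

Lemma is_derive_mx_comp n p q (M : 'cV[R]_n -> 'M[R]_(p, q))
    (x : R -> 'cV[R]_n) t (w : 'cV[R]_n) i j :
  differentiable M (x t) -> is_derive t 1 x w ->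
  is_derive t 1 (fun s => M (x s) i j) ('D_w M (x t) i j).
Proof.
move=> dM [dx xw]; apply: (@is_derive_entry p q (M \o x)).
have dfx : differentiable x t by exact/derivable1_diffP.
have dc : differentiable (M \o x) t by exact: differentiable_comp.
apply: DeriveDef; first exact: diff_derivable.
by rewrite !deriveE// diff_comp//= -xw deriveE.
Qed.

Lemma derive_symmetric n (M : 'cV[R]_n -> 'M[R]_n) q (w : 'cV[R]_n) :
  (forall y, (M y)^T = M y) -> differentiable M q ->
  ('D_w M q)^T = 'D_w M q.
Proof.
move=> sM dM; have hM : derivable M q w by exact: diff_derivable.
apply/matrixP => i j; rewrite mxE !derive_mx// !mxE; congr ('D_w _ q).
by apply/funext => y; rewrite -[in LHS]sM mxE.
Qed.

(** A skew matrix and its transpose add up to 0, and the derivative of a symmetric matrix is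
    symmetric, so twice the derivative is [2 (C + C^T)]. *)
Lemma derive_of_skew n (M : 'cV[R]_n -> 'M[R]_n) (C : 'M[R]_n) q (w : 'cV[R]_n) :
  (forall y, (M y)^T = M y) -> differentiable M q ->
  skew_symmetric ('D_w M q - 2 *: C) -> 'D_w M q = C + C^T.
Proof.
move=> sM dM; rewrite /skew_symmetric linearB linearZ /= derive_symmetric// => h.
apply/matrixP => i j; move/matrixP : h => /(_ i j); rewrite !mxE; lra.
Qed.

End Matrix_calculus.

(** * Functions that tend to 0 at infinity or are bounded at positive times *)

Section Vanishing.
Variable R : realType.
Implicit Types f g : R -> R.

Lemma vanish_le f g : (forall t, 0 < t -> `|f t| <= g t) ->
  g t @[t --> +oo] --> (0 : R) -> f t @[t --> +oo] --> (0 : R).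
Proof.
move=> fg g0; apply/cvgr0Pnorm_le => e e0; near=> t.
have t0 : 0 < t by near: t; exact: nbhs_pinfty_gt.
apply: le_trans (fg t t0) _; apply: le_trans (ler_norm _) _.
by near: t; exact: cvgr0_norm_le.
Unshelve. all: by end_near. Qed.

Lemma vanish_sum (I : Type) (s : seq I) (P : pred I) (f : I -> R -> R) :
  (forall i, P i -> f i t @[t --> +oo] --> (0 : R)) ->
  \sum_(i <- s | P i) f i t @[t --> +oo] --> (0 : R).
Proof.
move=> h; elim: s => [|i s IH].
  rewrite (_ : (fun _ => _) = cst 0); first exact: cvg_cst.
  by apply/funext => t; rewrite big_nil.
rewrite (_ : (fun _ => _) = fun t =>
    (if P i then f i t else 0) + \sum_(i <- s | P i) f i t); last first.
  by apply/funext => t; rewrite big_cons; case: ifP; rewrite ?add0r.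
rewrite -[X in _ --> X]addr0; apply: cvgD IH.
by case: (boolP (P i)) => [/h//|_]; exact: cvg_cst.
Qed.

Lemma vanish_norm f : f t @[t --> +oo] --> (0 : R) ->
  `|f t| @[t --> +oo] --> (0 : R).
Proof. by move=> h; rewrite -[X in _ --> X](@normr0 _ R); exact: cvg_norm. Qed.

Lemma vanish_scale (c : R) f : f t @[t --> +oo] --> (0 : R) ->
  c * f t @[t --> +oo] --> (0 : R).
Proof. by move=> h; rewrite -[X in _ --> X](mulr0 c); apply: cvgM => //; exact: cvg_cst. Qed.

Definition bounded_pos f := exists b, forall t, 0 < t -> `|f t| <= b.

Lemma vanish_mul_bounded f g : bounded_pos g ->
  f t @[t --> +oo] --> (0 : R) -> g t * f t @[t --> +oo] --> (0 : R).
Proof.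
move=> [B gB] f0; apply: (@vanish_le _ (fun t => B * `|f t|)) => [t t0|].
  by rewrite normrM ler_wpM2r// gB.
by apply: vanish_scale; exact: vanish_norm.
Qed.

Lemma vanish_sqr f g : (forall t, 0 < t -> f t ^+ 2 <= g t) ->
  g t @[t --> +oo] --> (0 : R) -> f t @[t --> +oo] --> (0 : R).
Proof.
move=> fg g0; apply/cvgr0Pnorm_le => e e0; near=> t.
have t0 : 0 < t by near: t; exact: nbhs_pinfty_gt.
rewrite -(ler_pXn2r (n := 2))// ?nnegrE ?(ltW e0)//.
rewrite real_normK ?num_real//; apply: le_trans (fg t t0) _.
apply: le_trans (ler_norm _) _.
by near: t; apply: cvgr0_norm_le => //; rewrite exprn_gt0.
Unshelve. all: by end_near. Qed.

Lemma window_vanish g (h l : R) : g t @[t --> +oo] --> l ->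
  g t - g (t - h) @[t --> +oo] --> (0 : R).
Proof.
move=> gl; rewrite -[X in _ --> X](subrr l); apply: cvgB => //.
apply: (@cvg_comp _ _ _ (fun t => t - h) g +oo +oo _) => //.
move=> A [m [mr hm]]; exists (m + h); split; first exact: num_real.
by move=> t /= mt; apply: hm; lra.
Qed.

Lemma finite_bound (I : finType) (T : Type) (P : T -> Prop) (f : I -> T -> R) :
  (forall i, exists b, forall t, P t -> f i t <= b) ->
  exists2 b, 0 <= b & forall i t, P t -> f i t <= b.
Proof.
move=> /choice[b hb]; exists (\sum_i `|b i|); first exact: sumr_ge0.
move=> i t Pt; apply: le_trans (hb i t Pt) _; apply: le_trans (ler_norm _) _.
by rewrite (bigD1 i)//= lerDl sumr_ge0.
Qed.

Lemma bounded_le f g : (forall t, 0 < t -> `|f t| <= g t) ->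
  bounded_pos g -> bounded_pos f.
Proof.
move=> fg [b gb]; exists b => t t0; apply: le_trans (fg t t0) _.
exact: le_trans (ler_norm _) (gb t t0).
Qed.

Lemma bounded_cst (c : R) : bounded_pos (fun _ => c).
Proof. by exists `|c|. Qed.

Lemma boundedD f g : bounded_pos f -> bounded_pos g ->
  bounded_pos (fun t => f t + g t).
Proof.
move=> [b fb] [c gc]; exists (b + c) => t t0.
by apply: le_trans (ler_normD _ _) _; rewrite lerD ?fb ?gc.
Qed.

Lemma boundedN f : bounded_pos f -> bounded_pos (fun t => - f t).
Proof. by move=> [b fb]; exists b => t t0; rewrite normrN fb. Qed.

Lemma boundedM f g : bounded_pos f -> bounded_pos g ->
  bounded_pos (fun t => f t * g t).
Proof.
move=> [b fb] [c gc]; exists (b * c) => t t0.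
by rewrite normrM ler_pM ?fb ?gc.
Qed.

Lemma bounded_sum (I : Type) (s : seq I) (P : pred I) (f : I -> R -> R) :
  (forall i, P i -> bounded_pos (f i)) ->
  bounded_pos (fun t => \sum_(i <- s | P i) f i t).
Proof.
move=> h; elim: s => [|i s IH].
  by exists 0 => t _; rewrite big_nil normr0.
rewrite (_ : (fun _ => _) = fun t =>
    (if P i then f i t else 0) + \sum_(i <- s | P i) f i t); last first.
  by apply/funext => t; rewrite big_cons; case: ifP; rewrite ?add0r.
apply: boundedD IH; case: (boolP (P i)) => [/h//|_]; exact: bounded_cst.
Qed.

Lemma bounded_sqr f g : (forall t, 0 < t -> f t ^+ 2 <= g t) ->
  bounded_pos g -> bounded_pos f.
Proof.
move=> fg [b gb]; exists (1 + b) => t t0.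
have h1 := fg t t0; have h2 := le_trans (ler_norm _) (gb t t0).
(* This square gives [|f| <= f^2 + 1/4], so the bound involves no root. *)
have := sqr_ge0 (`|f t| - 1 / 2); rewrite sqrrB real_normK ?num_real//.
lra.
Qed.

End Vanishing.

Lemma continuous_entry (R : realType) (T : topologicalType) p q
    (f : T -> 'M[R]_(p, q)) t i j :
  {for t, continuous f} -> {for t, continuous (fun s => f s i j)}.
Proof.
move=> cf; apply: (@continuous_comp _ _ _ f (fun A : 'M[R]_(p, q) => A i j)) => //.
exact: coord_continuous.
Qed.

(** * Periodic functions of the configuration *)

Section Revolute.
Variables (R : realType) (n : nat).

Lemma trmx_continuous p q : continuous (@trmx R p q).
Proof.
move=> A W [P hP PW]; exists (fun i j => P j i) => [i j|B hB].
  by have := hP j i; rewrite mxE.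
by apply: PW => i j; rewrite mxE.
Qed.

Lemma cV_box_compact (lo hi : R) :
  compact [set w : 'cV[R]_n | forall k, lo <= w k 0 <= hi].
Proof.
have -> : [set w : 'cV[R]_n | forall k, lo <= w k 0 <= hi] =
    @trmx R 1 n @` [set u : 'rV[R]_n | forall k, `[lo, hi]%classic (u ord0 k)].
  apply/seteqP; split => [w hw|_ [u hu <-] k].
    exists w^T; last by rewrite trmxK.
    by move=> k; rewrite /= mxE in_itv; exact: hw.
  by have := hu k; rewrite /= in_itv mxE.
apply: continuous_compact; last first.
  by apply: (@rV_compact R n (fun=> `[lo, hi]%classic)) => _; exact: segment_compact.
by apply: continuous_subspaceT; exact: trmx_continuous.
Qed.

Lemma revolute_int T (F : 'cV[R]_n -> T) (q : 'cV[R]_n) k (m : int) :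
  revolute F -> F (q + (m%:~R * (2 * pi)) *: delta_mx k 0) = F q.
Proof.
move=> hF; have nat_case (j : nat) (q' : 'cV[R]_n) :
    F (q' + (j%:R * (2 * pi)) *: delta_mx k 0) = F q'.
  elim: j q' => [|j IH] q'; first by rewrite mul0r scale0r addr0.
  by rewrite -natr1 mulrDl mul1r scalerDl addrA hF IH.
case: m => j; first exact: nat_case.
rewrite NegzE -[in RHS](subrK ((j.+1%:R * (2 * pi)) *: delta_mx k 0) q) nat_case.
by rewrite mulrNz mulNr scaleNr.
Qed.

Lemma revolute_reduce T (F : 'cV[R]_n -> T) (q : 'cV[R]_n) : revolute F ->
  exists2 q' : 'cV[R]_n, (forall k, 0 <= q' k 0 <= 2 * pi) & F q' = F q.
Proof.
move=> hF; have pi2 : 0 < 2 * pi :> R by rewrite mulr_gt0// pi_gt0.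
(* Undoing the integral part of the number of turns brings joint [k] into one period. *)
pose m (k : 'I_n) : int := - Num.floor (q k 0 / (2 * pi)).
exists (q + \sum_k ((m k)%:~R * (2 * pi)) *: delta_mx k 0); last first.
  elim: (index_enum _) => [|k s IH]; first by rewrite big_nil addr0.
  by rewrite big_cons [X in q + X]addrC addrA revolute_int.
move=> k; rewrite mxE summxE (bigD1 k)//= big1 => [|i ik]; last first.
  by rewrite !mxE [k == i]eq_sym (negbTE ik) mulr0.
rewrite !mxE !eqxx mulr1 addr0 /m mulrNz mulNr.
have := floor_itv (q k 0 / (2 * pi)); set f := _%:~R.
rewrite intrD -/f ler_pdivlMr// ltr_pdivrMr// mulrDl mul1r.
lra.
Qed.

(** Periodicity reduces the configuration to a compact cube, where continuity gives a bound. Only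
    the velocity has to be bounded beforehand, so the estimate applies to trajectories whose
    positions are not known to be bounded. *)
Lemma revolute_bounded p q (F : 'cV[R]_n -> 'cV[R]_n -> 'M[R]_(p, q)) (B : R) :
  continuous (fun z : 'cV[R]_n * 'cV[R]_n => F z.1 z.2) ->
  (forall w, revolute (F ^~ w)) ->
  exists2 c, 0 <= c & forall y w : 'cV[R]_n, (forall k, `|w k 0| <= B) ->
    forall i j, `|F y w i j| <= c.
Proof.
move=> cF rF.
(* Taking [|B|] keeps the box nonempty for negative [B], as the extreme value theorem requires. *)
pose box : set ('cV[R]_n * 'cV[R]_n) := [set y : 'cV[R]_n | forall k, 0 <= y k 0 <= 2 * pi] `*`
  [set w : 'cV[R]_n | forall k, - `|B| <= w k 0 <= `|B|].
have box_compact : compact box by apply: compact_setX; exact: cV_box_compact.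
have box0 : box !=set0.
  exists (0, 0); split=> k /=; rewrite mxE.
    by rewrite lexx mulr_ge0// pi_ge0.
  by rewrite oppr_le0 normr_ge0.
have [|c c0 hc] := @finite_bound R ('I_p * 'I_q)%type _
    box (fun ij z => `|F z.1 z.2 ij.1 ij.2|).
  move=> [i j] /=.
  have cij : continuous (fun z : 'cV[R]_n * 'cV[R]_n => `|F z.1 z.2 i j|).
    move=> z; apply: (@continuous_comp _ _ _
      (fun z : 'cV[R]_n * 'cV[R]_n => F z.1 z.2 i j) (fun y : R => `|y|)).
      exact: (@continuous_entry R _ p q (fun z : 'cV[R]_n * 'cV[R]_n => F z.1 z.2) z i j (cF z)).
    exact: norm_continuous.
  have [z _ zmax] := compact_EVT_max box0 box_compact (continuous_subspaceT cij).
  by exists `|F z.1 z.2 i j| => w wbox; apply: zmax; rewrite inE.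
exists c => // y w wB i j.
have [y' y'box <-] := revolute_reduce y (rF w).
apply: (hc (i, j) (y', w)); split=> // l /=.
by rewrite -ler_norml (le_trans (wB l))// ler_norm.
Qed.

End Revolute.

(** * Truncation of time at 0, limits from the left, finite minima *)

Lemma continuous_extend0 (R : realType) (V : topologicalType) (f : R -> V) :
  {within `[0, +oo[, continuous f} -> continuous (fun t : R => f (Num.max t 0)).
Proof.
move=> /subspace_continuousP cf t.
have m0 : `[0, +oo[%classic (Num.max t 0).
  by rewrite /= in_itv /= andbT le_max lexx orbT.
move=> W /(cf _ m0) hW.
have hW' : \forall z \near Num.max t 0, `[0, +oo[%classic z -> W (f z) by exact: hW.
have H := @continuous_maxr0 R t _ hW'.
apply: (@filterS _ (nbhs t) _ _ _ _ H) => s /= h; apply: h.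
by rewrite in_itv /= andbT le_max lexx orbT.
Qed.

Lemma near_ball_ex (R : realType) (t : R) (P : set R) :
  (\forall s \near t, P s) ->
  exists2 e, 0 < e & forall s, t - e < s < t + e -> P s.
Proof.
move=> /nbhs_ballP[e /= e0 eP]; exists e => // s se; apply: eP.
by rewrite /ball/= ltr_distlC; lra.
Qed.

Lemma continuous_le_left (R : realType) (f : R -> R) (a t c : R) :
  a < t -> {for t, continuous f} -> (forall s, a <= s < t -> f s <= c) ->
  f t <= c.
Proof.
move=> at_ cf fc; rewrite leNgt; apply/negP => cft.
have [e e0 he] := near_ball_ex (cvgr_gt _ cf _ cft).
pose s := Num.max a (t - e / 2).
have sm : a <= s by rewrite le_max lexx.
have se : t - e / 2 <= s by rewrite le_max lexx orbT.
have st : s < t by rewrite gt_max at_ /=; lra.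
have /he : t - e < s < t + e by lra.
by rewrite ltNge fc// sm.
Qed.

Lemma finite_lower_bound (R : realType) (I : finType) (f : I -> R) :
  (forall i, 0 < f i) -> exists2 c, 0 < c & forall i, c <= f i.
Proof.
move=> f0; exists (\big[Num.min/1]_i f i).
  by apply/lt_bigmin.
by move=> i; exact: bigmin_le.
Qed.

(** * Trajectories of the network and the action of each agent *)

Section Network.
Variables (R : realType) (n N : nat)
  (M : 'I_N -> 'cV[R]_n -> 'M[R]_n)
  (C : 'I_N -> 'cV[R]_n -> 'cV[R]_n -> 'M[R]_n)
  (g : 'I_N -> 'cV[R]_n -> 'cV[R]_n)
  (lam1 lam2 : 'I_N -> R).
Hypothesis hEL : forall i, EL_properties (M i) (C i) (lam1 i) (lam2 i).
Variable E : rel 'I_N.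
Hypothesis hEsym : symmetric E.
Variable d : 'I_N -> 'I_N -> R -> R.
Variables r Q p : R.
Hypotheses (hr : 0 < r) (hQ : 0 < Q) (hp : 0 < p).
Variable K : 'I_N -> 'M[R]_n.
Hypothesis hKdiag : forall i, is_diag_mx (K i).
Variables x v a tau : 'I_N -> R -> 'cV[R]_n.
Hypothesis hmotion : forall i, motion (x i) (v i) (a i).
Hypothesis hdyn : forall (i : 'I_N) (t : R), 0 < t ->
  M i (x i t) *m a i t + C i (x i t) (v i t) *m v i t + g i (x i t) = tau i t.
Hypothesis htau : forall (i : 'I_N) (t : R), 0 < t ->
  tau i t = control_torque r Q p E K g d x v i t.

Implicit Types (i j : 'I_N) (k l : 'I_n) (s t : R).

(* [v i] is unconstrained at negative times; the truncated velocity is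
   continuous on the whole line. *)
Definition vel i t : 'cV[R]_n := v i (Num.max t 0).

Lemma velE i t : 0 <= t -> vel i t = v i t.
Proof. by move=> t0; rewrite /vel max_l. Qed.

Lemma pos_history i t : t <= 0 -> x i t = x i 0.
Proof. exact: (motion_history (hmotion i)). Qed.

Lemma pos_continuous i : continuous (x i).
Proof.
have -> : x i = fun t => x i (Num.max t 0).
  apply/funext => t; case: (leP t 0) => // t0; exact: pos_history.
exact: continuous_extend0 (motion_continuous (hmotion i)).
Qed.

Lemma pos_entry_continuous i k : continuous (fun t => x i t k 0).
Proof. by move=> t; apply: continuous_entry; exact: pos_continuous. Qed.

Lemma vel_entry_continuous i k : continuous (fun t => vel i t k 0).
Proof.
move=> t; apply: continuous_entry.
exact: (continuous_extend0 (motion_velocity_continuous (hmotion i))).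
Qed.

Lemma pos_derive i t : 0 < t -> is_derive t 1 (x i) (vel i t).
Proof.
move=> t0; rewrite velE ?(ltW t0)//; exact: (motion_velocity (hmotion i)).
Qed.

Lemma pos_entry_derive i k t : 0 < t ->
  is_derive t 1 (fun s => x i s k 0) (vel i t k 0).
Proof. by move=> t0; apply: is_derive_entry; exact: pos_derive. Qed.

Lemma vel_entry_derive i k t : 0 < t ->
  is_derive t 1 (fun s => vel i s k 0) (a i t k 0).
Proof.
move=> t0; apply: (is_derive_eq_right t0 (f := fun s => v i s k 0)).
  by move=> s s0; rewrite velE// ltW.
apply: is_derive_entry; exact: (motion_acceleration (hmotion i)).
Qed.

Lemma sqr_vel_primitive i k : exists F : R -> R,
  [/\ forall t, t <= 0 -> F t = 0, continuous F,
    forall t, 0 < t -> is_derive t 1 F (vel i t k 0 ^+ 2)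
    & {homo F : s t / s <= t}].
Proof.
apply: primitive_from0 => [t|t]; last exact: sqr_ge0.
apply: continuousM; exact: vel_entry_continuous.
Qed.

(* The integral of [vel i t k 0 ^+ 2] from 0 to [t], and 0 for [t <= 0]. *)
Definition action_entry i k : R -> R := sval (cid (sqr_vel_primitive i k)).

Definition action i t : R := \sum_k action_entry i k t.

Lemma action_history i t : t <= 0 -> action i t = 0.
Proof.
move=> t0; apply: big1 => k _; rewrite /action_entry.
by case: cid => F [+ _ _ _] /=; exact.
Qed.

Lemma action_continuous i : continuous (action i).
Proof.
move=> t; apply: continuous_bigsum => k _; rewrite /action_entry.
by case: cid => F [_ + _ _] /=; exact.
Qed.

Lemma action_derive i t : 0 < t -> is_derive t 1 (action i) (sqnorm (vel i t)).
Proof.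
move=> t0; apply: is_derive_bigsum => k _; rewrite /action_entry.
by case: cid => F [_ _ + _] /=; exact.
Qed.

Lemma action_homo i : {homo action i : s t / s <= t}.
Proof.
move=> s t st; apply: ler_sum => k _; rewrite /action_entry.
by case: cid => F [_ _ _ +] /=; exact.
Qed.

Lemma action_ge0 i t : 0 <= action i t.
Proof.
case: (leP t 0) => [/action_history->//|t0].
by rewrite -(action_history i (lexx 0)) action_homo// ltW.
Qed.

Lemma sqnorm_displacement_le i s t : s <= t ->
  sqnorm (x i t - x i s) <= (t - s) * (action i t - action i s).
Proof.
move=> st; rewrite /action -sumrB mulr_sumr; apply: ler_sum => k _.
rewrite !mxE /action_entry; case: cid => F [F0 cF dF mF] /=.
apply: (@sqr_displacement_le R (fun t => x i t k 0) (fun t => vel i t k 0) F) => //.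
- exact: pos_entry_continuous.
- by move=> z z0; rewrite pos_history.
- by move=> z z0; exact: pos_entry_derive.
Qed.

(** Both factors of the Cauchy-Schwarz bound grow when the window is enlarged to length [h]. The
    result depends on the delay only through its bound, so an irregular delay does no harm. *)
Lemma sqnorm_delay_le i s t h : s <= t -> t - s <= h ->
  sqnorm (x i t - x i s) <= h * (action i t - action i (t - h)).
Proof.
move=> st sh; apply: le_trans (sqnorm_displacement_le i st) _.
have ts : action i s >= action i (t - h) by apply: action_homo; lra.
have tt : action i t >= action i s by exact: action_homo.
apply: ler_pM => //; lra.
Qed.

(** * The energy, its derivative and its dissipation *)

Definition linked t := forall i j, E i j -> sqnorm (x i t - x j t) <= r ^+ 2.

(** The truncated velocity makes the energy continuous at 0 as well. *)
Definition mech_energy t : R := energy r Q p E M x vel t.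

Definition grad_gap i j t : 'cV[R]_n :=
  grad_psi r Q (x i t - x j t) - grad_psi r Q (x i t - delayed x d i j t).

(** The time derivative of the energy along the closed loop, with gravity and Coriolis terms already
    cancelled. *)
Definition power t : R :=
  \sum_i (- \sum_k K i k k * vel i t k 0 ^+ 2
          + p * \sum_(j | E i j) \sum_k vel i t k 0 * grad_gap i j t k 0).

Lemma mech_energyE t : 0 <= t -> mech_energy t = energy r Q p E M x v t.
Proof.
move=> t0; rewrite /mech_energy /energy; congr (_ * _ + _).
by apply: eq_bigr => i _; rewrite velE.
Qed.

Lemma inertia_derive i t k l : 0 < t ->
  is_derive t 1 (fun s => M i (x i s) k l)
    (C i (x i t) (vel i t) k l + C i (x i t) (vel i t) l k).
Proof.
move=> t0; have [dM _ _ _ sM _ _ _ skew] := hEL i.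
have := is_derive_mx_comp k l (dM (x i t)) (pos_derive i t0).
by rewrite (derive_of_skew sM (dM _) (skew _ (vel i t)))// !mxE.
Qed.

Lemma closed_loop i t k : 0 < t ->
  (M i (x i t) *m a i t) k 0 =
  - (C i (x i t) (vel i t) *m vel i t) k 0
  - p * \sum_(j | E i j) grad_psi r Q (x i t - delayed x d i j t) k 0
  - K i k k * vel i t k 0.
Proof.
move=> t0; have := hdyn i t0; rewrite htau// /control_torque -velE ?(ltW t0)//.
move=> /matrixP /(_ k 0); rewrite !mxE.
rewrite (_ : \sum_(j < n) K i k j * vel i t j 0 = (K i *m vel i t) k 0); last by rewrite mxE.
rewrite diag_mulmx_entry// summxE => h.
by apply: (addIr (g i (x i t) k 0)); move: h; lra.
Qed.

(** The derivative [C + C^T] of the inertia matrix contributes twice the Coriolis power, which the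
    Coriolis term of the equation of motion cancels. *)
Lemma kinetic_derive i t : 0 < t ->
  is_derive t 1 (fun s => qform (M i (x i s)) (vel i s))
    (2 * \sum_k vel i t k 0 *
      (- (p * \sum_(j | E i j) grad_psi r Q (x i t - delayed x d i j t) k 0)
       - K i k k * vel i t k 0)).
Proof.
move=> t0; have [_ _ _ _ sM _ _ _ _] := hEL i.
rewrite (_ : (fun _ => _) = fun s => \sum_k \sum_l
    vel i s k 0 * M i (x i s) k l * vel i s l 0); last first.
  by apply/funext => s; rewrite qformE.
pose Mt := M i (x i t); pose Ct := C i (x i t) (vel i t); pose w := vel i t.
have der : is_derive t 1
    (fun s => \sum_k \sum_l vel i s k 0 * M i (x i s) k l * vel i s l 0)
    (\sum_k \sum_l ((a i t k 0 * Mt k l + w k 0 * (Ct k l + Ct l k)) * w l 0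
       + w k 0 * Mt k l * a i t l 0)).
  apply: is_derive_bigsum => k _; apply: is_derive_bigsum => l _.
  apply: is_deriveM_pt; last exact: vel_entry_derive.
  by apply: is_deriveM_pt; [exact: vel_entry_derive|exact: inertia_derive].
apply: (is_derive_eq der).
have symM k l : Mt l k = Mt k l by have /matrixP /(_ k l) := sM (x i t); rewrite mxE.
transitivity (2 * \sum_k \sum_l (w k 0 * (Mt k l * a i t l 0) + w k 0 * (Ct k l * w l 0))).
  (* Once both double sums are symmetrized in [k] and [l], they agree term by term. *)
  have sw (f : 'I_n -> 'I_n -> R) : \sum_k \sum_l f k l =
      2^-1 * \sum_k \sum_l (f k l + f l k).
    under [in RHS]eq_bigr do rewrite big_split.
    rewrite big_split /= [X in _ * (_ + X)]exchange_big /=; lra.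
  rewrite sw [in RHS]sw [RHS]mulrCA; congr (_ * _).
  rewrite mulr_sumr; apply: eq_bigr => k _; rewrite mulr_sumr; apply: eq_bigr => l _.
  rewrite (symM l k).
  move: (a i t k 0) (a i t l 0) (w k 0) (w l 0) (Mt l k) (Ct k l) (Ct l k).
  by move=> ak al wk wl m c1 c2; ring.
congr (_ * _); apply: eq_bigr => k _.
rewrite big_split /= -!mulr_sumr -mulrDr; congr (_ * _).
have := closed_loop i k t0; rewrite !mxE -/w -/Mt -/Ct; lra.
Qed.

Lemma potential_derive i j t : 0 < t -> sqnorm (x i t - x j t) <= r ^+ 2 ->
  is_derive t 1 (fun s => psi r Q (enorm (x i s - x j s)))
    (\sum_k grad_psi r Q (x i t - x j t) k 0 * (vel i t k 0 - vel j t k 0)).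
Proof.
move=> t0 lk.
rewrite (_ : (fun _ => _) = fun s => sqnorm (x i s - x j s) /
    (r ^+ 2 + Q - sqnorm (x i s - x j s))); last first.
  by apply/funext => s; rewrite psi_enormE.
pose y k := x i t k 0 - x j t k 0; pose w k := vel i t k 0 - vel j t k 0.
have dS : is_derive t 1 (fun s => sqnorm (x i s - x j s)) (\sum_k 2 * (y k * w k)).
  apply: is_derive_bigsum => k _.
  rewrite (_ : (fun _ => _) = fun s => (x i s k 0 - x j s k 0) ^+ 2); last first.
    by apply/funext => s; rewrite !mxE.
  by apply: is_deriveX2_pt; apply: is_deriveB_pt; exact: pos_entry_derive.
have den : r ^+ 2 + Q - sqnorm (x i t - x j t) != 0 by rewrite gt_eqF// psi_den_gt0.
have dden : is_derive t 1 (fun s => r ^+ 2 + Q - sqnorm (x i s - x j s))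
    (0 - \sum_k 2 * (y k * w k)).
  by apply: is_deriveB_pt dS.
apply: (is_derive_eq (@is_derive_div_pt R (fun s => sqnorm (x i s - x j s))
  (fun s => r ^+ 2 + Q - sqnorm (x i s - x j s)) t _ _ den dS dden)).
set c := r ^+ 2 + Q in den *; set S := sqnorm _ in den *.
have -> : \sum_k grad_psi r Q (x i t - x j t) k 0 * (vel i t k 0 - vel j t k 0)
    = 2 * c / (c - S) ^+ 2 * \sum_k y k * w k.
  by rewrite mulr_sumr; apply: eq_bigr => k _; rewrite grad_psiE !mxE mulrA.
by rewrite -mulr_sumr; field.
Qed.

Lemma mech_energy_derive t : 0 < t -> linked t ->
  is_derive t 1 mech_energy (power t).
Proof.
move=> t0 lk; rewrite /mech_energy /energy.
have dk := is_deriveMc_pt (1 / 2) (is_derive_bigsum (index_enum _)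
  (P := xpredT) (fun i _ => kinetic_derive i t0)).
have dp := is_deriveMc_pt (p / 2) (is_derive_bigsum (index_enum _)
  (P := xpredT) (fun i _ => is_derive_bigsum (index_enum _) (P := E i)
     (fun j ij => potential_derive t0 (lk i j ij)))).
apply: (is_derive_eq (is_deriveD_pt dk dp)).
(* The two ends of an edge contribute equally, which absorbs the factor 1/2 of the potential
   energy. *)
have dbl := @sum_antisymmetric R 'I_N 'I_n E
  (fun i j k => grad_psi r Q (x i t - x j t) k 0) (fun i k => vel i t k 0)
  hEsym (fun i j k => grad_psi_swap r Q (x i t) (x j t) k).
rewrite {}dbl -mulr_sumr !mulrA.
have -> : 1 / 2 * 2 = 1 :> R by field.
have -> : p / 2 * 2 = p by field.
rewrite mul1r mulr_sumr -big_split; apply: eq_bigr => i _ /=.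
rewrite [X in X + _](_ : _ = - \sum_k K i k k * vel i t k 0 ^+ 2
  - p * \sum_(j | E i j) \sum_k vel i t k 0 *
      grad_psi r Q (x i t - delayed x d i j t) k 0); last first.
  rewrite exchange_big /= mulr_sumr -!sumrN -big_split; apply: eq_bigr => k _ /=.
  rewrite -mulr_sumr; move: (\sum_(j | _) _) (vel i t k 0) (K i k k).
  by move=> S w kk; ring.
rewrite -addrA; congr (_ + _); rewrite addrC -mulrBr -sumrB; congr (_ * _).
apply: eq_bigr => j _; rewrite -sumrB; apply: eq_bigr => k _.
by rewrite -mulrBr /grad_gap !mxE.
Qed.

Lemma mech_energy_continuous t : linked t -> {for t, continuous mech_energy}.
Proof.
move=> lk; rewrite /mech_energy /energy.
apply: continuousD; apply: continuousM; try exact: cst_continuous.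
  apply: continuous_bigsum => i _.
  rewrite (_ : (fun _ => _) = fun s => \sum_k \sum_l
      vel i s k 0 * M i (x i s) k l * vel i s l 0); last first.
    by apply/funext => s; rewrite qformE.
  apply: continuous_bigsum => k _; apply: continuous_bigsum => l _.
  apply: continuousM; last exact: vel_entry_continuous.
  apply: continuousM; first exact: vel_entry_continuous.
  apply: continuous_entry.
  apply: (@continuous_comp _ _ _ (x i) (M i)); first exact: pos_continuous.
  apply: differentiable_continuous; exact: (inertia_differentiable (hEL i)).
apply: continuous_bigsum => i _; apply: continuous_bigsum => j ij.
rewrite (_ : (fun _ => _) = fun s => sqnorm (x i s - x j s) /
    (r ^+ 2 + Q - sqnorm (x i s - x j s))); last first.
  by apply/funext => s; rewrite psi_enormE.
have cS : {for t, continuous (fun s => sqnorm (x i s - x j s))}.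
  apply: continuous_bigsum => k _.
  rewrite (_ : (fun _ => _) = fun s => (x i s k 0 - x j s k 0) * (x i s k 0 - x j s k 0)); last first.
    by apply/funext => s; rewrite !mxE.
  by apply: continuousM; apply: continuousB; exact: pos_entry_continuous.
apply: continuousM => //; apply: continuousV.
  by rewrite gt_eqF// psi_den_gt0// lk.
by apply: continuousB => //; exact: cst_continuous.
Qed.

(** Delays, delay bounds, weights and mismatch constants are left abstract because the inequality is
    used twice: with the data of the theorem, and with shortened delays and a Lipschitz constant
    while nothing has moved yet. *)
Lemma energy_balance (T gam et : R) (h al : 'I_N -> 'I_N -> R)
    (dd : 'I_N -> 'I_N -> R -> R) (k : 'I_N -> R) :
  0 <= T -> (forall t, 0 <= t <= T -> linked t) ->
  0 <= gam -> 0 <= et -> (forall i j, 0 < al i j) -> (forall i j, 0 <= h i j) ->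
  (forall i l, k i <= K i l l) ->
  (forall i j t, 0 < t < T -> E i j -> 0 <= dd j i t <= h j i) ->
  (forall i j t l, 0 < t < T -> E i j -> `|grad_gap i j t l 0|
     <= gam * `|(x j t - x j (t - dd j i t)) l 0|
        + et * `|x j t - x j (t - dd j i t)|) ->
  mech_energy T + \sum_i (k i - p / 2 * \sum_(j | E i j)
      (al i j * (gam + et) + (gam + n%:R * et) * h i j ^+ 2 / al j i))
    * action i T <= mech_energy 0.
Proof.
move=> T0 lk gam0 et0 al0 h0 kK ddh gapP.
pose win j i := cid (window_integral (h0 j i) (@action_history j)
  (@action_continuous j) (@action_homo j)).
(* The derivative of [H j i] is the action of [j] over a window of length [h j i]; multiplied by
   [h j i] it bounds the squared lag. So [H j i] accumulates the cost of the delay. *)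
pose H j i := sval (win j i).
have H0 j i : H j i 0 = 0 by rewrite /H; case: (win j i) => ? [hc ? ? ?] /=; exact: hc.
have cH j i t : 0 <= t -> {for t, continuous (H j i)}.
  by rewrite /H; case: (win j i) => ? [? hc ? ?] /=; exact: hc.
have dH j i t : 0 <= t ->
    is_derive t 1 (H j i) (action j t - action j (t - h j i)).
  by rewrite /H; case: (win j i) => ? [? ? hc ?] /=; exact: hc.
have HB j i t : 0 <= t -> H j i t <= h j i * action j t.
  by rewrite /H; case: (win j i) => ? [? ? ? hc] /=; exact: hc.
(* The gain condition is split: [b] charges the share of Young's inequality that falls on the
   velocity of [i], and [c] the share that falls on the lag of [j]. *)
pose b i := k i - p / 2 * \sum_(j | E i j) al i j * (gam + et).
pose c i j := (gam + n%:R * et) / al i j * h j i.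
pose W t := mech_energy t + \sum_i (b i * action i t
  - p / 2 * \sum_(j | E i j) c i j * H j i t).
pose dW t := power t + \sum_i (b i * sqnorm (vel i t)
  - p / 2 * \sum_(j | E i j) c i j * (action j t - action j (t - h j i))).
have c0 i j : 0 <= c i j.
  by rewrite /c mulr_ge0// divr_ge0 ?addr_ge0 ?mulr_ge0// ltW.
have WT : W T <= W 0.
  apply: (@le_of_deriv_le0 R W dW) => //.
  - move=> t tT; apply: continuousD; first by apply: mech_energy_continuous; exact: lk.
    apply: continuous_bigsum => i _; apply: continuousB; apply: continuousM;
      try exact: cst_continuous.
      exact: action_continuous.
    apply: continuous_bigsum => j _; apply: continuousM; first exact: cst_continuous.
    by apply: cH; case/andP: tT.
  - move=> t /andP[t0 tT]; apply: is_deriveD_pt.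
      by apply: mech_energy_derive => //; apply: lk; rewrite !ltW.
    apply: is_derive_bigsum => i _; apply: is_deriveB_pt; apply: is_deriveMc_pt.
      exact: action_derive.
    apply: is_derive_bigsum => j _; apply: is_deriveMc_pt.
    by apply: dH; exact: ltW.
  - move=> t tT; rewrite /dW /power -big_split /=; apply: sumr_le0 => i _.
    have h1 : k i * sqnorm (vel i t) <= \sum_l K i l l * vel i t l 0 ^+ 2.
      by rewrite mulr_sumr; apply: ler_sum => l _; rewrite ler_wpM2r ?sqr_ge0.
    have h2 : \sum_(j | E i j) \sum_l vel i t l 0 * grad_gap i j t l 0 <=
        \sum_(j | E i j) (al i j * (gam + et) / 2 * sqnorm (vel i t) +
          c i j / 2 * (action j t - action j (t - h j i))).
      apply: ler_sum => j ij.
      have := inner_le_weighted (vel i t) (al0 i j) gam0 et0 (fun l => gapP i j t l tT ij).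
      move=> /le_trans; apply.
      rewrite lerD2l.
      have -> : c i j / 2 * (action j t - action j (t - h j i)) =
        (gam + n%:R * et) / (2 * al i j) *
        (h j i * (action j t - action j (t - h j i))).
        rewrite /c; move: (action j t - _) => D.
        by field; rewrite gt_eqF.
      have /andP[dd0 dd1] := ddh _ _ _ tT ij.
      apply: ler_wpM2l.
        by rewrite divr_ge0 ?addr_ge0 ?mulr_ge0// ltW.
      by apply: sqnorm_delay_le; lra.
    have {h2} := ler_wpM2l (ltW hp) h2; rewrite big_split /= mulrDr.
    have -> : \sum_(j | E i j) al i j * (gam + et) / 2 * sqnorm (vel i t) =
        (\sum_(j | E i j) al i j * (gam + et)) / 2 * sqnorm (vel i t).
      by rewrite !mulr_suml.
    have -> : \sum_(j | E i j) c i j / 2 * (action j t - action j (t - h j i)) =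
        2^-1 * \sum_(j | E i j) c i j * (action j t - action j (t - h j i)).
      by rewrite mulr_sumr; apply: eq_bigr => j _; rewrite mulrA [2^-1 * _]mulrC.
    rewrite /b; move: h1.
    move: (\sum_l _) (\sum_(j | E i j) \sum_l _) (\sum_(j | E i j) al i j * _)
      (\sum_(j | E i j) c i j * _) (sqnorm (vel i t)) => s1 s2 s3 s4 s5.
    by move=> h1 h2; lra.
have W0 : W 0 = mech_energy 0.
  rewrite /W big1 ?addr0// => i _; rewrite action_history// mulr0 big1 ?mulr0 ?subrr//.
  by move=> j _; rewrite H0 mulr0.
rewrite -W0; apply: le_trans WT; rewrite /W lerD2l.
pose e i j := (gam + n%:R * et) * h i j ^+ 2 / al j i.
(* Exchanging the ends of each edge moves the cost of a lag from the receiving agent to the one that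
   moved. This is why the condition on agent [i] carries [h i j] together with [al j i]. *)
have key : \sum_i \sum_(j | E i j) c i j * H j i T <=
    \sum_i \sum_(j | E i j) e i j * action i T.
  rewrite [leRHS](exchange_big_dep xpredT)//=; apply: ler_sum => i _.
  rewrite [leRHS](eq_bigl (E i)); last by move=> j; rewrite hEsym.
  apply: ler_sum => j ij.
  have -> : e j i * action j T = c i j * (h j i * action j T).
    by rewrite /e /c; field; rewrite gt_eqF.
  by rewrite ler_wpM2l// HB.
rewrite -subr_ge0 -sumrB.
rewrite (eq_bigr (fun i => p / 2 * (\sum_(j | E i j) e i j * action i T
    - \sum_(j | E i j) c i j * H j i T))) => [|i _].
  by rewrite -mulr_sumr sumrB mulr_ge0 ?subr_ge0// divr_ge0// ltW.
rewrite big_split /= /b.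
have -> : \sum_(j | E i j) e i j * action i T = (\sum_(j | E i j) e i j) * action i T.
  by rewrite mulr_suml.
rewrite -[\sum_(j | E i j) (gam + _) * _ ^+ 2 / _]/(\sum_(j | E i j) e i j).
move: (\sum_(j | _) al i j * _) (\sum_(j | _) e i j) (\sum_(j | _) c i j * _).
by move=> s1 s2 s3; ring.
Qed.

Lemma sqnormB_continuous i j t :
  {for t, continuous (fun s => sqnorm (x i s - x j s))}.
Proof.
apply: continuous_bigsum => k _.
rewrite (_ : (fun _ => _) = fun s => (x i s k 0 - x j s k 0) * (x i s k 0 - x j s k 0)).
  by apply: continuousM; apply: continuousB; exact: pos_entry_continuous.
by apply/funext => s; rewrite !mxE.
Qed.

(** The two times vary independently because a delayed position is read earlier than the current
    one. *)
Lemma sqnormB_continuous2 i j (z : R * R) :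
  {for z, continuous (fun z : R * R => sqnorm (x i z.1 - x j z.2))}.
Proof.
apply: continuous_bigsum => k _.
rewrite (_ : (fun _ => _) = fun z : R * R =>
    (x i z.1 k 0 - x j z.2 k 0) * (x i z.1 k 0 - x j z.2 k 0)); last first.
  by apply/funext => w; rewrite !mxE.
have c1 : {for z, continuous (fun z : R * R => x i z.1 k 0)}.
  apply: (@continuous_comp _ _ _ fst (fun s => x i s k 0)); first exact: cvg_fst.
  exact: pos_entry_continuous.
have c2 : {for z, continuous (fun z : R * R => x j z.2 k 0)}.
  apply: (@continuous_comp _ _ _ snd (fun s => x j s k 0)); first exact: cvg_snd.
  exact: pos_entry_continuous.
by apply: continuousM; apply: continuousB.
Qed.

Lemma kinetic_ge i t : lam1 i * sqnorm (vel i t) <= qform (M i (x i t)) (vel i t).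
Proof. by rewrite -qform_scalar; exact: (inertia_lower (hEL i)). Qed.

Lemma kinetic_ge0 i t : 0 <= qform (M i (x i t)) (vel i t).
Proof.
apply: le_trans (kinetic_ge i t).
by rewrite mulr_ge0 ?sqnorm_ge0// ltW// (inertia_lower_gt0 (hEL i)).
Qed.

Lemma potential_ge0 i j t : linked t -> E i j ->
  0 <= psi r Q (enorm (x i t - x j t)).
Proof.
move=> lk ij; rewrite psi_enormE divr_ge0 ?sqnorm_ge0// ltW//.
by rewrite psi_den_gt0// lk.
Qed.

Lemma kinetic_le_energy i t : linked t ->
  1 / 2 * qform (M i (x i t)) (vel i t) <= mech_energy t.
Proof.
move=> lk; rewrite /mech_energy /energy -[leLHS]addr0 lerD//.
  rewrite ler_wpM2l ?divr_ge0//.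
  by rewrite (bigD1 i)//= lerDl sumr_ge0// => j _; exact: kinetic_ge0.
rewrite mulr_ge0 ?divr_ge0 ?(ltW hp)//; apply: sumr_ge0 => j _.
by apply: sumr_ge0 => k jk; exact: potential_ge0.
Qed.

(** An edge occurs in the double sum in both orientations, so the factor [p / 2] still leaves it the
    full weight [p]; all other terms are nonnegative. *)
Lemma potential_le_energy i j t : linked t -> E i j ->
  p * psi r Q (enorm (x i t - x j t)) <= mech_energy t.
Proof.
move=> lk ij.
have inner i' : 0 <= \sum_(j' | E i' j') psi r Q (enorm (x i' t - x j' t)).
  by apply: sumr_ge0 => j' ij'; exact: potential_ge0.
have term i' j' : E i' j' -> psi r Q (enorm (x i' t - x j' t)) <=
    \sum_(j' | E i' j') psi r Q (enorm (x i' t - x j' t)).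
  move=> ij'; rewrite (bigD1 j')//= lerDl sumr_ge0// => k /andP[ik _].
  exact: potential_ge0.
rewrite /mech_energy /energy -[leLHS]add0r lerD//.
  by rewrite mulr_ge0 ?divr_ge0// sumr_ge0// => k _; exact: kinetic_ge0.
(* A loop occurs only once in the sum, but its potential is 0. *)
have [ijE|ij_neq] := eqVneq i j.
  rewrite ijE subrr psi_enormE (_ : sqnorm 0 = 0) ?mul0r ?mulr0.
    by rewrite mulr_ge0 ?divr_ge0 ?(ltW hp)// sumr_ge0.
  by rewrite /sqnorm big1// => k _; rewrite mxE expr0n.
have -> : p * psi r Q (enorm (x i t - x j t)) = p / 2 *
    (psi r Q (enorm (x i t - x j t)) + psi r Q (enorm (x j t - x i t))).
  rewrite -[x j t - _]opprB !psi_enormE sqnormN; move: (_ / _) => y.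
  by field.
rewrite ler_wpM2l ?divr_ge0 ?(ltW hp)//.
rewrite (bigD1 i)//= lerD ?term// (bigD1 j) 1?eq_sym//= -[leLHS]addr0.
by rewrite lerD ?term 1?hEsym// sumr_ge0.
Qed.

Lemma frozen_of_action0 i t : action i t = 0 -> forall s, s <= t -> x i s = x i t.
Proof.
move=> F0 s st; have := sqnorm_displacement_le i st.
have -> : action i s = 0.
  by apply/eqP; rewrite eq_le action_ge0 -F0 action_homo.
rewrite F0 subrr mulr0 => h; apply/matrixP => k l; rewrite ord1.
have := le_trans (sqr_entry_le_sqnorm (x i t - x i s) k) h.
rewrite !mxE => h2; apply/eqP; rewrite eq_sym -subr_eq0 -sqrf_eq0.
by rewrite eq_le h2 sqr_ge0.
Qed.

(** * Persistence of the energy bound and of the links *)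

Variable dbar : 'I_N -> 'I_N -> R.
Hypothesis hd : forall i j t, 0 <= t -> 0 <= d j i t <= dbar j i.
Variable eps : R.
Hypothesis heps : 0 < eps.
Variable k : 'I_N -> R.
Hypothesis hk : forall i, smallest_eigenvalue (K i) (k i).
Hypothesis hinit : forall i j, E i j -> enorm (x i 0 - x j 0) <= r - eps.
Variables gamma eta : R.
Hypotheses (hgamma : 0 < gamma) (heta : 0 < eta).
Hypothesis hmismatch : gradient_mismatch r Q p E M d x v gamma eta.
Hypothesis henergy :
  1 / 2 * \sum_(i < N) qform (M i (x i 0)) (v i 0)
  + p / 2 * \sum_(i < N) \sum_(j < N | E i j) psi r Q (enorm (x i 0 - x j 0))
  < p * psi r Q r.
Variable alpha : 'I_N -> 'I_N -> R.
Hypothesis halpha : forall i j, 0 < alpha i j.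
Hypothesis hgain : forall i : 'I_N,
  p / 2 * \sum_(j < N | E i j)
    (alpha i j * (gamma + eta)
     + (gamma + n%:R * eta) * dbar i j ^+ 2 / alpha j i)
  < k i.

(** The coefficient [c_i] of the action in the dissipation inequality. *)
Definition margin i : R := k i - p / 2 * \sum_(j < N | E i j)
    (alpha i j * (gamma + eta)
     + (gamma + n%:R * eta) * dbar i j ^+ 2 / alpha j i).

Lemma margin_gt0 i : 0 < margin i.
Proof. by rewrite /margin subr_gt0. Qed.

Lemma dbar_ge0 i j : 0 <= dbar i j.
Proof. by have /andP[/le_trans h /h] := hd j i (lexx 0). Qed.

Lemma gain_gt0 i : 0 < k i.
Proof.
apply: le_lt_trans (hgain i); rewrite mulr_ge0 ?divr_ge0 ?(ltW hp)//.
apply: sumr_ge0 => j _; have al0 := ltW (halpha i j); have al1 := ltW (halpha j i).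
have g0 := ltW hgamma; have e0 := ltW heta.
by rewrite addr_ge0// ?mulr_ge0 ?invr_ge0 ?addr_ge0 ?mulr_ge0 ?sqr_ge0 ?dbar_ge0.
Qed.

Lemma gain_le_diag i l : k i <= K i l l.
Proof. exact: smallest_eigenvalue_le_diag. Qed.

Lemma initial_energy_lt : mech_energy 0 < p * psi r Q r.
Proof. by rewrite mech_energyE. Qed.

(** The energy bound alone does not exclude large distances, as [psi] is negative beyond its pole;
    the links are therefore carried along. *)
Definition confined t := linked t /\ mech_energy t <= mech_energy 0.

(** A link stretched to length exactly [r] would by itself cost [p * psi r Q r], more than the
    initial energy. *)
Lemma confined_strict t i j : confined t -> E i j ->
  sqnorm (x i t - x j t) < r ^+ 2.
Proof.
move=> [lk en] ij; rewrite lt_neqAle lk// andbT; apply/negP => /eqP rE.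
have := le_lt_trans (le_trans (potential_le_energy lk ij) en) initial_energy_lt.
rewrite psi_enormE rE /psi ltr_pM2l// [r ^+ 2 - _ + _]addrAC.
by rewrite ltxx.
Qed.

Lemma confined0 : confined 0.
Proof.
split=> [i j ij|//]; rewrite ltW// -enorm_ltr//.
by apply: le_lt_trans (hinit ij) _; rewrite ltrBlDr ltrDl.
Qed.

Lemma confined_gap i j t l : 0 <= t -> confined t -> E i j ->
  `|grad_gap i j t l 0| <= gamma * `|(x j t - x j (t - d j i t)) l 0|
    + eta * `|x j t - x j (t - d j i t)|.
Proof.
move=> t0 [_ en] ij; apply: hmismatch => //.
by rewrite -!mech_energyE.
Qed.

Lemma confined_dissipation T : 0 <= T ->
  (forall t, 0 <= t <= T -> confined t) ->
  mech_energy T + \sum_i margin i * action i T <= mech_energy 0.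
Proof.
move=> T0 cT; apply: (energy_balance (gam := gamma) (et := eta) (dd := d)) => //.
- by move=> t /cT[].
- exact: ltW.
- exact: ltW.
- exact: dbar_ge0.
- exact: gain_le_diag.
- by move=> i j t /andP[/ltW/hd].
- by move=> i j t l /andP[t0 tT] ij; apply: confined_gap => //; rewrite ?ltW//; apply: cT; rewrite !ltW.
Qed.

Lemma near_edges (T : topologicalType) (z : T) (P : 'I_N -> 'I_N -> T -> Prop) :
  (forall i j, E i j -> \forall w \near z, P i j w) ->
  \forall w \near z, forall i j, E i j -> P i j w.
Proof.
move=> h; apply: (@filter_forall _ _ (fun i w => forall j, E i j -> P i j w)) => i.
apply: (@filter_forall _ _ (fun j w => E i j -> P i j w)) => j.
have [ij|nij] := boolP (E i j); last by near=> w.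
by apply: filterS (h i j ij).
Unshelve. all: by end_near. Qed.

(** The inequality in [linked] is not strict and thus survives the limit; being linked at [t] then
    makes the energy continuous there, so its bound survives too. *)
Lemma confined_left t : 0 < t -> (forall s, 0 <= s < t -> confined s) ->
  confined t.
Proof.
move=> t0 ct.
have lk : linked t.
  move=> i j ij; apply: (continuous_le_left (a := 0) (f := fun s => sqnorm (x i s - x j s)) t0).
    exact: sqnormB_continuous.
  by move=> s /ct[+ _]; exact.
split => //; apply: (continuous_le_left t0); first exact: mech_energy_continuous.
by move=> s /ct[].
Qed.

(* As long as nothing has moved, every delayed position lies in the segment
   travelled since [t], so the delays act as if bounded by the elapsed time. *)
Lemma confined_right_frozen t : 0 <= t -> (forall s, 0 <= s <= t -> confined s) ->
  (forall i, action i t = 0) ->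
  exists2 e, 0 < e & forall s, t < s < t + e -> confined s.
Proof.
move=> t0 ct F0.
have fr i s : s <= t -> x i s = x i t by exact: frozen_of_action0.
have cft : confined t by apply: ct; rewrite t0 lexx.
have [L L0 hL] := @grad_psi_lipschitz R n r Q hr hQ.
have [e e0 he] : exists2 e, 0 < e & forall i j s s', E i j ->
    t - e < s < t + e -> t - e < s' < t + e -> sqnorm (x i s - x j s') <= r ^+ 2.
  have : \forall z \near ((t, t) : R * R), forall i j, E i j ->
      sqnorm (x i z.1 - x j z.2) < r ^+ 2.
    apply: near_edges => i j ij.
    exact: (cvgr_lt _ (@sqnormB_continuous2 i j (t, t)) _ (confined_strict cft ij)).
  move=> /nbhs_ballP[e /= e0 eP]; exists e => // i j s s' ij hs hs'.
  apply/ltW/(eP (s, s')) => //; split; rewrite /ball/= ltr_distlC; lra.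
(* With mismatch constants 0 and [L], and all weights and delay bounds equal to [h], the gain
   condition demands at most [h * B]. A small [h] brings this below the smallest gain [c]. *)
pose B := p / 2 * \sum_(j < N) (L + n%:R * L).
have B0 : 0 <= B.
  rewrite mulr_ge0 ?divr_ge0 ?(ltW hp)// sumr_ge0// => j _.
  by rewrite addr_ge0 ?mulr_ge0 ?(ltW L0).
have [c c0 hc] := finite_lower_bound gain_gt0.
pose h := Num.min e (c / (B + 1)).
have h0 : 0 < h by rewrite lt_min e0 divr_gt0// ltr_wpDl.
have he' : h <= e by rewrite ge_min lexx.
have hB : h * B <= c.
  apply: (@le_trans _ _ (c / (B + 1) * B)).
    by rewrite ler_wpM2r// ge_min lexx orbT.
  rewrite mulrAC ler_pdivrMr ?ltr_wpDl// ler_wpM2l ?(ltW c0)//; lra.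
exists h => // s /andP[ts sh].
have lks u : 0 <= u <= s -> linked u.
  move=> /andP[u0 us]; have [ut|tu] := leP u t; first by case: (ct u); rewrite ?u0.
  by move=> i j ij; apply: he => //; lra.
split; first by apply: lks; rewrite lexx andbT; lra.
(* A delay reaching back past [t] is cut at [t], which leaves the position read unchanged. *)
pose dd j i u := if u <= t then 0 else Num.min (d j i u) (u - t).
have ddE j i u : 0 <= u -> x j (u - d j i u) = x j (u - dd j i u).
  move=> u0; have /andP[d0 _] := hd i j u0; rewrite /dd; case: leP => ut.
    by rewrite subr0 [LHS]fr ?[RHS]fr//; lra.
  have [//|dl] := leP (d j i u) (u - t).
  by rewrite subKr fr//; lra.
(* The given mismatch bound presupposes the energy bound to be proved here. The Lipschitz constant
   [L] for the sup norm stands in for [eta], with 0 for [gamma]. *)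
have := @energy_balance s 0 L (fun _ _ => h) (fun _ _ => h) dd k _ lks (lexx 0) (ltW L0)
  (fun _ _ => h0) (fun _ _ => ltW h0) gain_le_diag.
set S := \sum_i _ => bal; apply: le_trans (bal _ _ _); last 3 first.
- by lra.
- move=> i j u /andP[u0 us] ij; rewrite /dd; case: (leP u t) => ut; first by rewrite lexx ltW.
  have /andP[d0 _] := hd i j (ltW u0).
  rewrite le_min d0 /= ge_min; apply/andP; split; first lra.
  by apply/orP; right; lra.
- move=> i j u l /andP[u0 us] ij; rewrite mul0r add0r /grad_gap /delayed ddE ?(ltW u0)//.
  set y := x j (u - _).
  have -> : x j u - y = - ((x i u - x j u) - (x i u - y)).
    by rewrite opprB opprD !opprK addrACA subrr add0r addrC.
  rewrite normrN; apply: hL.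
    by apply: lks => //; rewrite !ltW.
  have [ut|tu] := leP u t.
    rewrite /y /dd ut subr0; case: (ct u) => [|lk _]; last exact: lk.
    by rewrite ut ltW.
  have /andP[d0 _] := hd i j (ltW u0).
  apply: he => //; first lra.
  rewrite /dd leNgt tu /=; have [?|?] := leP (d j i u) (u - t); lra.
rewrite lerDl; apply: sumr_ge0 => i _; rewrite mulr_ge0 ?action_ge0// subr_ge0.
apply: le_trans (hc i); apply: le_trans hB; rewrite /B [leRHS]mulrCA ler_wpM2l ?divr_ge0 ?(ltW hp)//.
rewrite mulr_sumr big_mkcond /=; apply: ler_sum => j _.
have -> : h * (0 + L) + (0 + n%:R * L) * h ^+ 2 / h = h * (L + n%:R * L).
  by field; rewrite gt_eqF.
case: ifP => // _; rewrite mulr_ge0 ?addr_ge0 ?mulr_ge0 ?(ltW h0) ?(ltW L0)//.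
Qed.

Lemma confined_right t : 0 <= t -> (forall s, 0 <= s <= t -> confined s) ->
  exists2 e, 0 < e & forall s, t < s < t + e -> confined s.
Proof.
move=> t0 ct; have [F0|] := pselect (forall i, action i t = 0).
  exact: confined_right_frozen.
move=> /existsNP[i0 /eqP Fi0].
have cft : confined t by apply: ct; rewrite t0 lexx.
have lt0 : mech_energy t < mech_energy 0.
  apply: lt_le_trans (confined_dissipation t0 ct); rewrite ltrDl (bigD1 i0)//=.
  apply: ltr_wpDr.
    by apply: sumr_ge0 => i _; rewrite mulr_ge0 ?action_ge0// ltW// margin_gt0.
  by rewrite mulr_gt0 ?margin_gt0// lt_neqAle eq_sym Fi0 action_ge0.
have [e1 e10 h1] := near_ball_ex (cvgr_lt _ (mech_energy_continuous cft.1) _ lt0).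
have : \forall s \near t, forall i j, E i j -> sqnorm (x i s - x j s) < r ^+ 2.
  apply: near_edges => i j ij.
  exact: (cvgr_lt _ (@sqnormB_continuous i j t) _ (confined_strict cft ij)).
move=> /near_ball_ex[e2 e20 h2].
exists (Num.min e1 e2); first by rewrite lt_min e10.
move=> s /andP[ts se]; have [se1 se2] : s < t + e1 /\ s < t + e2.
  by move: se; rewrite -ltrBlDl lt_min => /andP[]; lra.
split; last by apply/ltW/h1; lra.
by move=> i j ij; apply/ltW/h2 => //; lra.
Qed.

Lemma confined_forever t : 0 <= t -> confined t.
Proof.
move: t; apply: real_induction.
- exact: confined0.
- exact: confined_left.
- exact: confined_right.
Qed.

Lemma linked_forever t : 0 <= t -> linked t.
Proof. by move=> /confined_forever[]. Qed.

(** * Decay of the velocities and of the coupling forces *)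

Lemma dissipation t : 0 <= t ->
  mech_energy t + \sum_i margin i * action i t <= mech_energy 0.
Proof.
by move=> t0; apply: confined_dissipation => // s /andP[s0 _]; exact: confined_forever.
Qed.

Lemma action_le i t : action i t <= mech_energy 0 / margin i.
Proof.
apply: (@le_trans _ _ (action i (Num.max t 0))).
  by apply: action_homo; rewrite le_max lexx.
set s := Num.max t 0; have s0 : 0 <= s by rewrite le_max lexx orbT.
rewrite ler_pdivlMr ?margin_gt0// mulrC; apply: le_trans (dissipation s0).
rewrite -[leLHS]add0r lerD//.
  apply: le_trans (kinetic_le_energy i (linked_forever s0)).
  by rewrite mulr_ge0 ?divr_ge0// kinetic_ge0.
rewrite (bigD1 i)//= lerDl; apply: sumr_ge0 => j _.
by rewrite mulr_ge0 ?action_ge0// ltW// margin_gt0.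
Qed.

Lemma action_cvg i : exists l : R, action i t @[t --> +oo] --> l.
Proof.
by apply: (nondecreasing_bounded_cvg (@action_homo i)) => t; exact: action_le.
Qed.

Lemma vel_entry_bounded i l : bounded_pos (fun t => vel i t l 0).
Proof.
have lam0 := inertia_lower_gt0 (hEL i).
apply: (bounded_sqr (g := fun _ => mech_energy 0 * 2 / lam1 i)); last exact: bounded_cst.
move=> t t0; rewrite ler_pdivlMr// mulrC.
have [lk en] := confined_forever (ltW t0).
have := le_trans (kinetic_le_energy i lk) en.
have := le_trans (ler_wpM2l (ltW lam0) (sqr_entry_le_sqnorm (vel i t) l)) (kinetic_ge i t).
by lra.
Qed.

Definition lag i j t : 'cV[R]_n := x j t - x j (t - d j i t).

Lemma sqr_lag_le i j t : 0 < t ->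
  `|lag i j t| ^+ 2 <= dbar j i * (action j t - action j (t - dbar j i)).
Proof.
move=> t0; apply: le_trans (sqr_norm_le_sqnorm _) _.
have /andP[d0 d1] := hd i j (ltW t0); apply: sqnorm_delay_le; lra.
Qed.

(** The action is nondecreasing and bounded, hence convergent, so its increments over windows of
    fixed length tend to 0. *)
Lemma lag_vanish i j : `|lag i j t| @[t --> +oo] --> (0 : R).
Proof.
apply: (vanish_sqr (@sqr_lag_le i j)); apply: vanish_scale.
by have [l hl] := action_cvg j; exact: window_vanish hl.
Qed.

Lemma lag_bounded i j : bounded_pos (fun t => `|lag i j t|).
Proof.
apply: (bounded_sqr (@sqr_lag_le i j)); apply: boundedM; first exact: bounded_cst.
have actB h : bounded_pos (fun t => action j (t - h)).
  exists (mech_energy 0 / margin j) => t _.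
  by rewrite ger0_norm ?action_ge0// action_le.
apply: boundedD (boundedN (actB _)).
by exists (mech_energy 0 / margin j) => t _; rewrite ger0_norm ?action_ge0// action_le.
Qed.

Lemma gap_le i j l t : E i j -> 0 < t ->
  `|grad_gap i j t l 0| <= (gamma + eta) * `|lag i j t|.
Proof.
move=> ij t0; have t0' := ltW t0.
apply: le_trans (confined_gap l t0' (confined_forever t0') ij) _.
by rewrite mulrDl lerD2r ler_wpM2l ?(ltW hgamma)// mx_entry_le.
Qed.

Lemma gap_vanish i j l : E i j -> grad_gap i j t l 0 @[t --> +oo] --> (0 : R).
Proof.
move=> ij; apply: (vanish_le (fun t => gap_le l ij)).
by apply: vanish_scale; exact: lag_vanish.
Qed.

Lemma gap_bounded i j l : E i j -> bounded_pos (fun t => grad_gap i j t l 0).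
Proof.
move=> ij; apply: (bounded_le (fun t => gap_le l ij)).
by apply: boundedM (bounded_cst _) (lag_bounded _ _).
Qed.

(** Coupling through current positions. Unlike the coupling applied by the controller, it is
    Lipschitz in time whatever the delays. *)
Definition force i l t : R :=
  p * \sum_(j | E i j) grad_psi r Q (x i t - x j t) l 0.

Lemma grad_bounded i j l : E i j ->
  bounded_pos (fun t => grad_psi r Q (x i t - x j t) l 0).
Proof.
move=> ij; have [L L0 hL] := @grad_psi_lipschitz R n r Q hr hQ.
exists (L * r) => t t0; have lk := linked_forever (ltW t0) ij.
have s0 : sqnorm (0 : 'cV[R]_n) <= r ^+ 2.
  by rewrite /sqnorm big1 ?sqr_ge0// => k' _; rewrite mxE expr0n.
have := hL _ _ lk s0 l; rewrite mxE [X in _ + X]mxE.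
have -> : grad_psi r Q (0 : 'cV[R]_n) l 0 = 0 by rewrite grad_psiE mxE mulr0.
rewrite !subr0 => /le_trans; apply; rewrite ler_wpM2l ?(ltW L0)//.
by apply: cV_norm_le => [|k']; [exact: ltW|exact: norm_entry_le].
Qed.

Lemma force_bounded i l : bounded_pos (force i l).
Proof.
apply: boundedM; first exact: bounded_cst.
by apply: bounded_sum => j ij; exact: grad_bounded.
Qed.

Lemma closed_loop_force i t l : 0 < t ->
  (M i (x i t) *m a i t) l 0 =
  - (C i (x i t) (vel i t) *m vel i t) l 0 - force i l t
  + p * (\sum_(j | E i j) grad_gap i j t l 0) - K i l l * vel i t l 0.
Proof.
move=> t0; rewrite closed_loop//.
have -> : \sum_(j | E i j) grad_gap i j t l 0 =
  \sum_(j | E i j) grad_psi r Q (x i t - x j t) l 0 -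
  \sum_(j | E i j) grad_psi r Q (x i t - delayed x d i j t) l 0.
  by rewrite -sumrB; apply: eq_bigr => j _; rewrite !mxE.
rewrite /force mulrBr; move: (p * _) (p * _) (_ *m _) => s1 s2 y.
by congr (_ - _); rewrite [RHS]addrA subrK.
Qed.

Lemma coriolis_bounded i l m : bounded_pos (fun t => C i (x i t) (vel i t) l m).
Proof.
have [B _ hB] : exists2 b, 0 <= b & forall l' t, 0 < t -> `|vel i t l' 0| <= b.
  by apply: finite_bound => l'; exact: vel_entry_bounded.
have [c _ hc] := @revolute_bounded R n n n (C i) B (coriolis_continuous (hEL i))
  (coriolis_revolute (hEL i)).
by exists c => t t0; apply: hc => k'; exact: hB.
Qed.

Lemma inertia_bounded i l m : bounded_pos (fun t => M i (x i t) l m).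
Proof.
have cM : continuous (fun z : 'cV[R]_n * 'cV[R]_n => M i z.1).
  move=> z; apply: (@continuous_comp _ _ _ fst (M i)); first exact: cvg_fst.
  by apply: differentiable_continuous; exact: (inertia_differentiable (hEL i)).
have [c _ hc] := @revolute_bounded R n n n (fun q _ => M i q) 0 cM
  (fun _ => inertia_revolute (hEL i)).
by exists c => t t0; apply: (hc (x i t) 0) => k'; rewrite mxE normr0.
Qed.

(** The equation of motion bounds the entries of [M a] by some [D]; then
    [lam1 |a|^2 <= a^T M a <= n D |a|] in the sup norm, without inverting [M]. *)
Lemma accel_entry_bounded i l : bounded_pos (fun t => a i t l 0).
Proof.
have lam0 := inertia_lower_gt0 (hEL i).
have [D D0 hD] : exists2 b, 0 <= b &
    forall l' t, 0 < t -> `|(M i (x i t) *m a i t) l' 0| <= b.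
  apply: finite_bound => l'.
  have [b hb] : bounded_pos (fun t =>
      - (\sum_m C i (x i t) (vel i t) l' m * vel i t m 0) - force i l' t
      + p * (\sum_(j | E i j) grad_gap i j t l' 0) - K i l' l' * vel i t l' 0).
    apply: boundedD (boundedN (boundedM (bounded_cst _) (vel_entry_bounded i l'))).
    apply: boundedD.
      apply: boundedD (boundedN (force_bounded i l')).
      apply: boundedN; apply: bounded_sum => m _.
      exact: boundedM (coriolis_bounded i l' m) (vel_entry_bounded i m).
    apply: boundedM (bounded_cst _) _.
    by apply: bounded_sum => j ij; exact: gap_bounded.
  by exists b => t t0; have := hb t t0; rewrite closed_loop_force// [(_ *m _) l' 0]mxE.
exists (n%:R * D / lam1 i) => t t0.
apply: le_trans (mx_entry_le (a i t) l 0) _; set A := `|a i t|.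
have A0 : 0 <= A by exact: normr_ge0.
have [AE|A1] := eqVneq A 0.
  by rewrite AE divr_ge0 ?mulr_ge0// ltW.
have Ap : 0 < A by rewrite lt_neqAle eq_sym A1.
rewrite ler_pdivlMr// -(ler_pM2l Ap).
have h1 : lam1 i * A ^+ 2 <= qform (M i (x i t)) (a i t).
  apply: le_trans (inertia_lower (hEL i) (x i t) (a i t)).
  by rewrite qform_scalar ler_wpM2l ?(ltW lam0)// sqr_norm_le_sqnorm.
have h2 : qform (M i (x i t)) (a i t) <= A * (n%:R * D).
  rewrite qformE.
  have -> : A * (n%:R * D) = \sum_(l' < n) A * D.
    by rewrite sumr_const card_ord -mulr_natl; ring.
  apply: ler_sum => l' _.
  have -> : \sum_m a i t l' 0 * M i (x i t) l' m * a i t m 0 =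
      a i t l' 0 * (M i (x i t) *m a i t) l' 0.
    by rewrite mxE mulr_sumr; apply: eq_bigr => m _; rewrite mulrA.
  apply: le_trans (ler_norm _) _; rewrite normrM ler_pM// ?hD//.
  exact: mx_entry_le.
have -> : A * (A * lam1 i) = lam1 i * A ^+ 2 by ring.
exact: le_trans h1 h2.
Qed.

(** Barbalat's lemma for the convergent action: its derivative, the squared speed, is Lipschitz
    because velocities and accelerations are bounded. *)
Lemma vel_vanish i l : vel i t l 0 @[t --> +oo] --> (0 : R).
Proof.
apply: (vanish_sqr (g := fun t => sqnorm (vel i t))).
  by move=> t _; exact: sqr_entry_le_sqnorm.
have [y hy] := action_cvg i.
have [B hB] : bounded_pos (fun t => \sum_m 2 * (vel i t m 0 * a i t m 0)).
  apply: bounded_sum => m _; apply: boundedM (bounded_cst _) _.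
  exact: boundedM (vel_entry_bounded i m) (accel_entry_bounded i m).
have dS t : 0 < t -> is_derive t 1 (fun t => sqnorm (vel i t))
    (\sum_m 2 * (vel i t m 0 * a i t m 0)).
  move=> t0; apply: is_derive_bigsum => m _; apply: is_deriveX2_pt.
  exact: vel_entry_derive.
have : - sqnorm (vel i t) @[t --> +oo] --> (0 : R).
  apply: (@barbalat_perturbed R (fun t => action i t - y)
      (fun t => - sqnorm (vel i t)) (fun _ => 0) B).
  - move=> t t0; rewrite (_ : 0 - _ = sqnorm (vel i t) - 0); last by rewrite sub0r opprK subr0.
    by apply: is_deriveB_pt; exact: action_derive.
  - move=> s t s0 st; rewrite -opprD normrN.
    apply: (@dist_le_of_deriv R (fun t => sqnorm (vel i t))
      (fun t => \sum_m 2 * (vel i t m 0 * a i t m 0))) => //.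
    + move=> z /andP[sz _]; apply: is_derive_continuous_pt (dS _ _).
      exact: lt_le_trans sz.
    + by move=> z /andP[sz _]; apply: dS; exact: lt_trans sz.
    + by move=> z /andP[sz _]; apply: hB; exact: lt_trans sz.
  - by rewrite -[X in _ --> X](subrr y); apply: cvgB => //; exact: cvg_cst.
  - exact: cvg_cst.
move=> h; rewrite (_ : (fun _ => _) = fun t => (-1) * - sqnorm (vel i t)).
  exact: vanish_scale.
by apply/funext => t; rewrite mulN1r opprK.
Qed.

Definition momentum i l t : R := \sum_m M i (x i t) l m * vel i t m 0.

(** The Coriolis entries are transposed: of the derivative [C + C^T] of the inertia matrix, [C]
    cancels in the equation of motion and [C^T] remains. *)
Definition momentum_error i l t : R :=
  \sum_m C i (x i t) (vel i t) m l * vel i t m 0 - K i l l * vel i t l 0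
  + p * \sum_(j | E i j) grad_gap i j t l 0.

Lemma momentum_derive i l t : 0 < t ->
  is_derive t 1 (momentum i l) (momentum_error i l t - force i l t).
Proof.
move=> t0.
have der : is_derive t 1 (momentum i l) (\sum_m
    ((C i (x i t) (vel i t) l m + C i (x i t) (vel i t) m l) * vel i t m 0
     + M i (x i t) l m * a i t m 0)).
  apply: is_derive_bigsum => m _; apply: is_deriveM_pt.
    exact: inertia_derive.
  exact: vel_entry_derive.
apply: (is_derive_eq der); rewrite big_split /=.
have -> : \sum_m M i (x i t) l m * a i t m 0 = (M i (x i t) *m a i t) l 0.
  by rewrite mxE.
rewrite closed_loop_force// [(_ *m _) l 0]mxE.
under eq_bigr do rewrite mulrDl.
rewrite big_split /= /momentum_error.
move: (\sum_m _) (\sum_m _) (p * _) (K i l l * _) (force i l t) => s1 s2 s3 s4 s5.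
ring.
Qed.

Lemma momentum_vanish i l : momentum i l t @[t --> +oo] --> (0 : R).
Proof.
apply: vanish_sum => m _; apply: vanish_mul_bounded (vel_vanish _ _).
exact: inertia_bounded.
Qed.

Lemma momentum_error_vanish i l : momentum_error i l t @[t --> +oo] --> (0 : R).
Proof.
rewrite -[X in _ --> X]addr0; apply: cvgD; last first.
  by apply: vanish_scale; apply: vanish_sum => j ij; exact: gap_vanish.
rewrite -[X in _ --> X]subr0; apply: cvgB; last by apply: vanish_scale; exact: vel_vanish.
apply: vanish_sum => m _; apply: vanish_mul_bounded (vel_vanish _ _).
exact: coriolis_bounded.
Qed.

Lemma pos_lipschitz : exists2 B, 0 <= B & forall i s t, 0 < s -> s <= t ->
  `|x i t - x i s| <= B * (t - s).
Proof.
have [B B0 hB] : exists2 b, 0 <= b &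
    forall (il : 'I_N * 'I_n) t, 0 < t -> `|vel il.1 t il.2 0| <= b.
  by apply: finite_bound => -[i l]; exact: vel_entry_bounded.
exists B => // i s t s0 st; apply: cV_norm_le => [|l].
  by rewrite mulr_ge0// subr_ge0.
rewrite !mxE; apply: (@dist_le_of_deriv R (fun t => x i t l 0) (fun t => vel i t l 0)) => //.
- by move=> z _; exact: pos_entry_continuous.
- by move=> z /andP[sz _]; apply: pos_entry_derive; exact: lt_trans sz.
- by move=> z /andP[sz _]; apply: (hB (i, l)); exact: lt_trans sz.
Qed.

(** Barbalat again, for the vanishing momentum. Its derivative is split so that the delays occur
    only in the error, which tends to 0, while the Lipschitz bound concerns the force alone. *)
Lemma force_vanish i l : force i l t @[t --> +oo] --> (0 : R).
Proof.
have [B B0 hB] := pos_lipschitz.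
have [L L0 hL] := @grad_psi_lipschitz R n r Q hr hQ.
apply: (barbalat_perturbed (L := p * \sum_(j < N | E i j) L * (2 * B))
  (fun t => @momentum_derive i l t) _ (momentum_vanish i l) (momentum_error_vanish i l)).
move=> s t s0 st; rewrite /force -mulrBr normrM gtr0_norm// -mulrA ler_wpM2l ?(ltW hp)//.
rewrite -sumrB mulr_suml; apply: le_trans (ler_norm_sum _ _ _) _.
apply: ler_sum => j ij.
have t0 := lt_le_trans s0 st.
have := hL _ _ (linked_forever (ltW t0) ij) (linked_forever (ltW s0) ij) l.
rewrite mxE [X in _ + X]mxE => /le_trans; apply.
rewrite -mulrA ler_wpM2l ?(ltW L0)//.
have -> : x i t - x j t - (x i s - x j s) = (x i t - x i s) - (x j t - x j s).
  by rewrite !opprB addrACA [RHS]addrACA; congr (_ + _); rewrite addrC.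
apply: le_trans (ler_normB _ _) _.
have := hB i s t s0 st; have := hB j s t s0 st; lra.
Qed.

(** * Synchronization through connectedness of the graph *)

Hypothesis hEconn : forall i j : 'I_N, connect E i j.

Lemma connected_rel (T : 'I_N -> 'I_N -> Prop) : (forall i, T i i) ->
  (forall i j h, E i j -> T j h -> T i h) -> forall i j, T i j.
Proof.
move=> Trefl Tstep i j; have /connectP[s] := hEconn i j.
elim: s i => [|h s IH] i /=; first by move=> _ ->.
by move=> /andP[ih hs] jE; apply: Tstep ih _; exact: IH.
Qed.

(** Each edge of a path adds at most [r], which bounds differences although no bound on the
    positions themselves is at hand. *)
Lemma relative_bounded i j l : bounded_pos (fun t => x i t l 0 - x j t l 0).
Proof.
move: i j; apply: connected_rel => [i|i j h ij [b hb]].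
  by exists 0 => t _; rewrite subrr normr0.
exists (r + b) => t t0.
rewrite -(subrKA (x j t l 0)); apply: le_trans (ler_normD _ _) _; rewrite lerD ?hb//.
by have := norm_entry_le l hr (linked_forever (ltW t0) ij); rewrite !mxE.
Qed.

(** The forces tend to 0 and are paired with bounded relative positions, so the pairing [Z] tends to
    0. By antisymmetry [Z] is also a sum of nonnegative edge terms, each comparable to a squared
    edge length. *)
Lemma edge_sqnorm_vanish i j : E i j ->
  sqnorm (x i t - x j t) @[t --> +oo] --> (0 : R).
Proof.
move=> ij; pose w i' l t := x i' t l 0 - x i t l 0.
pose Z t := \sum_i' \sum_l w i' l t * force i' l t.
have Z0 : Z t @[t --> +oo] --> (0 : R).
  apply: vanish_sum => i' _; apply: vanish_sum => l _.
  by apply: vanish_mul_bounded (force_vanish _ _); exact: relative_bounded.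
pose c := r ^+ 2 + Q.
have c0 : 0 < c by rewrite addr_gt0 ?exprn_gt0.
apply: (vanish_le (g := fun t => c / p * Z t)); last exact: vanish_scale.
move=> t t0; rewrite ger0_norm ?sqnorm_ge0//.
have lk := linked_forever (ltW t0).
pose G i' j' l := grad_psi r Q (x i' t - x j' t) l 0.
have dbl := @sum_antisymmetric R 'I_N 'I_n E G (fun i' l => w i' l t)
  hEsym (fun i' j' l => grad_psi_swap r Q (x i' t) (x j' t) l).
have ZE : Z t = p * \sum_i' \sum_(j' | E i' j') \sum_l w i' l t * G i' j' l.
  rewrite mulr_sumr; apply: eq_bigr => i' _.
  rewrite exchange_big /= mulr_sumr; apply: eq_bigr => l _.
  by rewrite -mulr_sumr /force mulrCA.
(* The coefficient in [grad_psi] is smallest at distance 0, where it equals [2 / c]. *)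
have term i' j' : E i' j' -> 2 / c * sqnorm (x i' t - x j' t) <=
    \sum_l G i' j' l * (w i' l t - w j' l t).
  move=> ij'; have den0 := psi_den_gt0 hQ (lk i' j' ij').
  have S0 := sqnorm_ge0 (x i' t - x j' t).
  have -> : \sum_l G i' j' l * (w i' l t - w j' l t) =
      2 * c / (c - sqnorm (x i' t - x j' t)) ^+ 2 * sqnorm (x i' t - x j' t).
    rewrite [in RHS]/sqnorm mulr_sumr -/(sqnorm _); apply: eq_bigr => l _.
    rewrite /G grad_psiE -/c -mulrA; congr (_ * _); rewrite /w !mxE.
    by move: (x i' t l 0) (x j' t l 0) (x i t l 0) => y1 y2 y3; ring.
  rewrite ler_wpM2r//; rewrite -/c in den0.
  move: S0 den0; move: (sqnorm _) => S S0 den0.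
  rewrite ler_pdivrMr// mulrAC ler_pdivlMr ?exprn_gt0//.
  have : (c - S) ^+ 2 <= c ^+ 2 by rewrite ler_pXn2r ?nnegrE ?gerBl// ltW.
  by rewrite -mulrA -expr2 ler_pM2l.
have pos i' j' : E i' j' -> 0 <= \sum_l G i' j' l * (w i' l t - w j' l t).
  move=> ij'; apply: le_trans (term i' j' ij').
  by rewrite mulr_ge0 ?sqnorm_ge0// divr_ge0// ltW.
(* The chosen edge is one of the nonnegative terms whose sum is [2 / p * Z t]. *)
have tot : 2 / c * sqnorm (x i t - x j t) <= 2 / p * Z t.
  rewrite ZE mulrA mulfVK ?gt_eqF// -dbl.
  apply: le_trans (term i j ij) _.
  rewrite (bigD1 i)//= (bigD1 j)//= -addrA lerDl addr_ge0//.
    by apply: sumr_ge0 => j' /andP[ij' _]; exact: pos.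
  by apply: sumr_ge0 => i' _; apply: sumr_ge0 => j' ij'; exact: pos.
have : c / 2 * (2 / c * sqnorm (x i t - x j t)) <= c / 2 * (2 / p * Z t).
  by rewrite ler_wpM2l// divr_ge0// ltW.
have -> : c / 2 * (2 / c * sqnorm (x i t - x j t)) = sqnorm (x i t - x j t).
  by move: (sqnorm _) => S; field; rewrite gt_eqF.
have -> // : c / 2 * (2 / p * Z t) = c / p * Z t.
by move: (Z t) => z; field; rewrite gt_eqF.
Qed.

Lemma relative_vanish i j l : x i t l 0 - x j t l 0 @[t --> +oo] --> (0 : R).
Proof.
move: i j; apply: connected_rel => [i|i j h ij jh].
  rewrite (_ : (fun _ => _) = cst 0); first exact: cvg_cst.
  by apply/funext => t; rewrite subrr.
rewrite (_ : (fun _ => _) = fun t =>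
    (x i t l 0 - x j t l 0) + (x j t l 0 - x h t l 0)); last first.
  by apply/funext => t; rewrite addrA subrK.
rewrite -[X in _ --> X]addr0; apply: cvgD jh.
apply: vanish_sqr (edge_sqnorm_vanish ij) => t _.
by have := sqr_entry_le_sqnorm (x i t - x j t) l; rewrite !mxE.
Qed.

Lemma synchronization i j : x i t - x j t @[t --> +oo] --> (0 : 'cV[R]_n).
Proof.
apply/cvgr0Pnorm_le => e e0.
have : \forall t \near +oo, forall l, `|x i t l 0 - x j t l 0| <= e.
  apply: (@filter_forall _ _ (fun l t => `|x i t l 0 - x j t l 0| <= e)) => l.
  by have /cvgr0_norm_le := relative_vanish i j l; exact.
apply: filterS => t h; apply: cV_norm_le => [|l]; first exact: ltW.
by have := h l; rewrite !mxE.
Qed.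

Lemma connectivity i j t : E i j -> 0 <= t -> enorm (x i t - x j t) < r.
Proof.
move=> ij t0; rewrite enorm_ltr//; apply: confined_strict ij.
exact: confined_forever.
Qed.

End Network.

Theorem mainTheorem2 (R : realType) (n N : nat)
    (M : 'I_N -> 'cV[R]_n -> 'M[R]_n)
    (C : 'I_N -> 'cV[R]_n -> 'cV[R]_n -> 'M[R]_n)
    (g : 'I_N -> 'cV[R]_n -> 'cV[R]_n)
    (lam1 lam2 : 'I_N -> R)
    (hEL : forall i, EL_properties (M i) (C i) (lam1 i) (lam2 i))
    (E : rel 'I_N) (hEsym : symmetric E)
    (hEconn : forall i j : 'I_N, connect E i j)
    (d : 'I_N -> 'I_N -> R -> R) (dbar : 'I_N -> 'I_N -> R)
    (hd : forall (i j : 'I_N) (t : R), 0 <= t -> 0 <= d j i t <= dbar j i)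
    (r Q p eps : R) (hr : 0 < r) (hQ : 0 < Q) (hp : 0 < p) (heps : 0 < eps)
    (hpsi : N%:R * (N%:R - 1) / 2 * psi r Q (r - eps) < psi r Q r)
    (K : 'I_N -> 'M[R]_n) (k : 'I_N -> R)
    (hKdiag : forall i, is_diag_mx (K i))
    (hKpos : forall (i : 'I_N) (l : 'I_n), 0 < K i l l)
    (hk : forall i, smallest_eigenvalue (K i) (k i))
    (x v a tau : 'I_N -> R -> 'cV[R]_n)
    (hmotion : forall i, motion (x i) (v i) (a i))
    (hdyn : forall (i : 'I_N) (t : R), 0 < t ->
      M i (x i t) *m a i t + C i (x i t) (v i t) *m v i t + g i (x i t)
      = tau i t)
    (htau : forall (i : 'I_N) (t : R), 0 < t ->
      tau i t = control_torque r Q p E K g d x v i t)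
    (hinit : forall i j : 'I_N, E i j -> enorm (x i 0 - x j 0) <= r - eps)
    (gamma eta : R) (hgamma : 0 < gamma) (heta : 0 < eta)
    (hmismatch : gradient_mismatch r Q p E M d x v gamma eta)
    (henergy :
      1 / 2 * \sum_(i < N) qform (M i (x i 0)) (v i 0)
      + p / 2 * \sum_(i < N) \sum_(j < N | E i j) psi r Q (enorm (x i 0 - x j 0))
      < p * psi r Q r)
    (alpha : 'I_N -> 'I_N -> R) (halpha : forall i j, 0 < alpha i j)
    (hgain : forall i : 'I_N,
      p / 2 * \sum_(j < N | E i j)
        (alpha i j * (gamma + eta)
         + (gamma + n%:R * eta) * dbar i j ^+ 2 / alpha j i)
      < k i) :
  (forall i j : 'I_N, x i t - x j t @[t --> +oo] --> (0 : 'cV[R]_n)) /\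
  (forall (i j : 'I_N) (t : R), E i j -> 0 <= t -> enorm (x i t - x j t) < r).
Proof.
split=> [i j|i j t ij t0].
  exact: (synchronization hEL hEsym hr hQ hp hKdiag hmotion hdyn htau hd heps hk
    hinit hgamma heta hmismatch henergy halpha hgain hEconn).
exact: (connectivity hEL hEsym hr hQ hp hKdiag hmotion hdyn htau hd heps hk
  hinit hgamma heta hmismatch henergy halpha hgain).
Qed.
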